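(* (Chevalley-type theorem) Let $1\le k<l$. The ring $\mathcal A=\mathcal A^{(k,k+1)}(A_l)$ is isomorphic to the ring of polynomials of $\tilde y_1(x),\dots,\tilde y_{l+2}(x)$.
   Context: Let $\mathbb R^{l+1}$ have orthonormal basis $\epsilon_1,\dots,\epsilon_{l+1}$ and let $V=\{\sum v_s\epsilon_s:\sum v_s=0\}$ with the induced inner product $(\,,\,)$. Put $\alpha_j=\alpha_j^\vee=\epsilon_j-\epsilon_{j+1}$ ($1\le j\le l$); $\omega_1,\dots,\omega_l\in V$ are the fundamental weights, $(\omega_i,\alpha_j^\vee)=\delta_{ij}$; $W$ is the Weyl group of type $A_l$ acting on $V$ by permuting $v_1,\dots,v_{l+1}$. Coordinates $x_1,\dots,x_l$ on $V$: $\mathbf x=\sum x_j\alpha_j^\vee$, i.e. $v_1=x_1$, $v_j=x_j-x_{j-1}$ ($2\le j\le l$), $v_{l+1}=-x_l$. Let $y_j(\mathbf x)=\sigma_j(e^{2\pi i v_1},\dots,e^{2\pi i v_{l+1}})$, $1\le j\le l$ (elementary symmetric functions). The group $\widetilde W=\widetilde W^{(k,k+1)}(A_l)$ acts on $\widetilde V=V\oplus\mathbb R^2\ni x=(\mathbf x,x_{l+1},x_{l+2})$ and is generated by the transformations $x\mapsto(w(\mathbf x)+\sum_{j=1}^l m_j\alpha_j^\vee,x_{l+1},x_{l+2})$ ($w\in W$, $m_j\in\mathbb Z$), $x\mapsto(\mathbf x+\omega_k,x_{l+1}-1,x_{l+2})$, $x\mapsto(\mathbf x+\omega_{k+1},x_{l+1},x_{l+2}-1)$.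 $\mathcal A$ is the ring of all $\widetilde W$-invariant Fourier polynomials of $x_1,\dots,x_l,\frac1{l+1}x_{l+1},\frac1{l+1}x_{l+2}$ (finite complex linear combinations of $\exp 2\pi i(\sum_{j\le l} m_jx_j+\frac{m_{l+1}x_{l+1}+m_{l+2}x_{l+2}}{l+1})$, $m_j\in\mathbb Z$) that are bounded in both limits (a) $\mathbf x=\mathbf x^0-i\omega_k\tau$, $x_{l+1}=x_{l+1}^0+i\tau$, $x_{l+2}=x_{l+2}^0$, $\tau\to+\infty$; (b) $\mathbf x=\mathbf x^0-i\omega_{k+1}\tau$, $x_{l+1}=x_{l+1}^0$, $x_{l+2}=x_{l+2}^0+i\tau$, $\tau\to+\infty$, for any $x^0=(\mathbf x^0,x^0_{l+1},x^0_{l+2})$. With $d_{j,r}:=(\omega_j,\omega_r)$, $$\tilde y_j(x)=e^{2\pi i(d_{j,k}x_{l+1}+d_{j,k+1}x_{l+2})}y_j(\mathbf x)\ (1\le j\le l),\quad\tilde y_{l+1}(x)=e^{2\pi i x_{l+1}},\quad\tilde y_{l+2}(x)=e^{2\pi i x_{l+2}}.$$ *)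

(* Defs.v *)
From HB Require Import structures.
From mathcomp Require Import all_boot all_order all_algebra perm complex.
From mathcomp Require Import -(notations) mpoly.
From mathcomp Require Import boolp classical_sets functions reals topology.
From mathcomp Require Import normedtype sequences exp trigo.

Set Implicit Arguments.
Unset Strict Implicit.
Unset Printing Implicit Defensive.

Import Order.TTheory GRing.Theory Num.Theory.
Import numFieldTopology.Exports.

Local Open Scope ring_scope.
Local Open Scope complex_scope.

(* V is the hyperplane of sum-zero vectors in F^(l+1).  The vectors eps, alpha
   and omega are indexed from 1, whereas the entries of row vectors are indexed
   from 0: the s-th entry of v is v_(s+1). *)
Section RootSystem.
Variables (F : numFieldType) (l : nat).
Implicit Types (u v : 'rV[F]_l.+1) (x : 'rV[F]_l).

Definition eps (j : nat) : 'rV[F]_l.+1 := \row_s (s.+1 == j)%:R.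

Definition alpha (j : nat) : 'rV[F]_l.+1 := eps j - eps j.+1.

Definition inner u v : F := \sum_s u 0 s * v 0 s.

Definition inV v : Prop := \sum_s v 0 s = 0.

(* omegaP shows that these are the fundamental weights. *)
Definition omega (j : nat) : 'rV[F]_l.+1 :=
  \row_s ((s < j)%N%:R - j%:R / l.+1%:R).

Definition vec x : 'rV[F]_l.+1 := \sum_(j < l) x 0 j *: alpha j.+1.

(* Inverse of vec on V (vecK, coordsK): since v_1 = x_1 and v_j = x_j - x_(j-1),
   x_j = v_1 + ... + v_j. *)
Definition coords v : 'rV[F]_l := \row_j \sum_(s < l.+1 | (s <= j)%N) v 0 s.

(* (bold x, x_(l+1), x_(l+2)), with bold x given by (x_1, ..., x_l). *)
Definition Vtilde : Type := ('rV[F]_l * F * F)%type.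

Inductive Wtilde (k : nat) : (Vtilde -> Vtilde) -> Prop :=
| Wtilde_affine (w : 'S_l.+1) (m : 'I_l -> int) :
    Wtilde k (fun x : Vtilde =>
      (coords (col_perm w (vec x.1.1) + \sum_j (m j)%:~R *: alpha j.+1),
       x.1.2, x.2))
| Wtilde_omega1 :
    Wtilde k (fun x : Vtilde => (coords (vec x.1.1 + omega k), x.1.2 - 1, x.2))
| Wtilde_omega2 :
    Wtilde k (fun x : Vtilde => (coords (vec x.1.1 + omega k.+1), x.1.2, x.2 - 1))
| Wtilde_id : Wtilde k id
| Wtilde_comp g h : Wtilde k g -> Wtilde k h -> Wtilde k (g \o h)
| Wtilde_inv g h : Wtilde k g -> cancel g h -> cancel h g -> Wtilde k h.

Lemma vecE x (s : 'I_l.+1) :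
  vec x 0 s = \sum_(j < l) x 0 j * ((s == j :> nat)%:R - (s == j.+1 :> nat)%:R).
Proof. by rewrite /vec summxE; apply: eq_bigr => j _; rewrite !mxE !eqSS. Qed.

Lemma vec_inV x : inV (vec x).
Proof.
rewrite /inV; under eq_bigr do rewrite vecE.
rewrite exchange_big big1 //= => j _; rewrite -mulr_sumr sumrB.
rewrite (bigD1 (widen_ord (leqnSn l) j)) //= eqxx big1 => [|i]; last first.
  by rewrite -val_eqE /= => /negPf->.
rewrite (bigD1 (lift ord0 j)) //= /bump leq0n add1n eqxx big1 => [|i].
  by rewrite subrr mulr0.
by rewrite -val_eqE /= /bump leq0n add1n => /negPf->.
Qed.

Lemma vecK : cancel vec coords.
Proof.
move=> x; apply/rowP => j; rewrite mxE.
under eq_bigr do rewrite vecE.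
rewrite exchange_big /= (bigD1 j) //= [X in _ + X]big1 ?addr0 => [|i neq_ij]; last first.
  rewrite -mulr_sumr sumrB.
  have H (t : nat) : (t <= l)%N ->
    \sum_(s < l.+1 | (s <= j)%N) (s == t :> nat)%:R = (t <= j)%N%:R :> F.
    move=> tl; case: leqP => tj.
      rewrite (bigD1 (Ordinal (tl : (t < l.+1)%N))) //= eqxx big1 ?addr0 // => s.
      by rewrite -val_eqE /= => /andP[_ /negPf->].
    rewrite big1 // => s sj; case: eqP => // E; move: tj.
    by rewrite -E ltnNge sj.
  rewrite !H ?(ltnW (ltn_ord i)) ?ltn_ord // leq_eqVlt.
  by rewrite val_eqE (negPf neq_ij) /= subrr mulr0.
rewrite -mulr_sumr sumrB.
rewrite (bigD1 (widen_ord (leqnSn l) j)) //= eqxx big1 => [|i]; last first.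
  by rewrite -val_eqE /= => /andP[_ /negPf->].
rewrite big1 => [|s sj]; first by rewrite addr0 subr0 mulr1.
by case: eqP => // E; move: sj; rewrite E ltnn.
Qed.

Lemma coords_inj v : inV v -> coords v = 0 -> v = 0.
Proof.
move=> sumv0 cv0; pose S t := \sum_(s < l.+1 | (s < t)%N) v 0 s.
have S0 t : (t <= l.+1)%N -> S t = 0.
  case: t => [|t]; first by rewrite /S big_pred0.
  rewrite ltnS leq_eqVlt => /predU1P[->|tl].
    by rewrite -[RHS]sumv0; apply: eq_bigl => s; rewrite ltn_ord.
  by have /rowP/(_ (Ordinal tl)) := cv0; rewrite !mxE.
apply/rowP => s; have := S0 _ (ltn_ord s).
rewrite mxE /S (bigD1 s) //= (eq_bigl (fun i : 'I__ => (i < s)%N)) => [|i].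
  by rewrite -/(S s) (S0 _ (ltnW (ltn_ord s))) addr0.
by rewrite ltnS [in RHS]ltn_neqAle andbC.
Qed.

Lemma coordsK v : inV v -> vec (coords v) = v.
Proof.
move=> vV; apply/eqP; rewrite -subr_eq0; apply/eqP/coords_inj.
  rewrite /inV; under eq_bigr do rewrite mxE [X in _ + X]mxE.
  by rewrite sumrB vec_inV vV subrr.
apply/rowP => j; rewrite mxE.
under eq_bigr do rewrite mxE [X in _ + X]mxE.
have /rowP/(_ j) := vecK (coords v); rewrite mxE => E.
by rewrite sumrB E !mxE subrr.
Qed.

Lemma inner_alpha u (j : nat) (jl : (j < l)%N) :
  inner u (alpha j.+1) =
  u 0 (widen_ord (leqnSn l) (Ordinal jl)) - u 0 (lift ord0 (Ordinal jl)).
Proof.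
rewrite /inner; under eq_bigr do rewrite !mxE !eqSS mulrBr.
rewrite sumrB; congr (_ - _).
  rewrite (bigD1 (widen_ord (leqnSn l) (Ordinal jl))) //= eqxx mulr1 big1.
    by rewrite addr0.
  by move=> i; rewrite -val_eqE /= => /negPf->; rewrite mulr0.
rewrite (bigD1 (lift ord0 (Ordinal jl))) //= /bump leq0n add1n eqxx mulr1 big1.
  by rewrite addr0.
by move=> i; rewrite -val_eqE /= /bump leq0n add1n => /negPf->; rewrite mulr0.
Qed.

Lemma omegaP u (i : nat) : (1 <= i <= l)%N ->
  u = omega i <->
  inV u /\ forall j, (1 <= j <= l)%N -> inner u (alpha j) = (i == j)%:R.
Proof.
move=> /andP[i1 il].
have oV : inV (omega i).
  rewrite /inV; under eq_bigr do rewrite mxE.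
  rewrite sumrB sumr_const card_ord -[X in _ - X]mulr_natr divfK ?pnatr_eq0 //.
  apply/eqP; rewrite subr_eq0; apply/eqP.
  have := @big_ord_widen_cond _ 0 +%R i l.+1 xpredT (fun=> 1 : F) (leqW il).
  rewrite /= big_const_ord iter_addr_0 => ->.
  by rewrite [RHS]big_mkcond; apply: eq_bigr => s _; case: ifP.
have oP j : (1 <= j <= l)%N -> inner (omega i) (alpha j) = (i == j)%:R.
  case: j => // j /= jl; rewrite inner_alpha !mxE /= /bump leq0n add1n.
  rewrite opprB addrA subrK.
  by case: (ltngtP i j.+1); rewrite ?subrr ?subr0.
split=> [->|[uV uP]]; first by [].
apply/eqP; rewrite -subr_eq0; set d := u - _.
have dE s : d 0 s = d 0 ord0.
  case: s => s; elim: s => [|s IHs] h; first by congr (d 0 _); exact: val_inj.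
  have sl : (s < l)%N by [].
  rewrite -(IHs (ltnW h)); have := uP s.+1; rewrite -oP ?sl //.
  move=> /(_ isT); rewrite !inner_alpha => E.
  have -> : Ordinal h = lift ord0 (Ordinal sl) by exact: val_inj.
  have -> : Ordinal (ltnW h) = widen_ord (leqnSn l) (Ordinal sl).
    exact: val_inj.
  have dE t : d 0 t = u 0 t - omega i 0 t by rewrite /d mxE [X in _ + X]mxE.
  rewrite !dE -[u 0 (lift _ _)](subKr (u 0 (widen_ord (leqnSn l) (Ordinal sl)))).
  by rewrite E opprB addrAC addrA subrK.
have d0 : d 0 ord0 = 0.
  have : \sum_s d 0 s = 0.
    under eq_bigr do rewrite mxE [X in _ + X]mxE.
    by rewrite sumrB uV oV subrr.
  under eq_bigr do rewrite dE.
  by rewrite sumr_const card_ord => /eqP; rewrite mulrn_eq0 => /eqP.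
by apply/eqP/rowP => s; rewrite dE d0 mxE.
Qed.

End RootSystem.

Section ComplexExponential.
Variable R : realType.

Definition cexp (z : R[i]) : R[i] :=
  let: a +i* b := z in (expR a)%:C * (cos b +i* sin b).

Definition e2pi (z : R[i]) : R[i] := cexp ((0 +i* (2 * pi)) * z).

Lemma cexpD z w : cexp (z + w) = cexp z * cexp w.
Proof.
case: z w => [a b] [c d]; rewrite /cexp /= expRD cosD sinD rmorphM mulrACA.
by congr (_ * _); apply/eqP; rewrite eq_complex /= eqxx addrC eqxx.
Qed.

Lemma cexp0 : cexp 0 = 1.
Proof. by rewrite /cexp /= expR0 cos0 sin0 mul1r. Qed.

Lemma e2piD z w : e2pi (z + w) = e2pi z * e2pi w.
Proof. by rewrite /e2pi mulrDr cexpD. Qed.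

Lemma e2pi0 : e2pi 0 = 1.
Proof. by rewrite /e2pi mulr0 cexp0. Qed.

End ComplexExponential.

Section InvariantFourierPolynomials.
Variables (R : realType) (l : nat).

(* Fourier polynomials are viewed as functions on the complexification of
   Vtilde R l, as the limits (a) and (b) leave the real space.  The group
   Wtilde acts on the real space and the base points x0 are real. *)
Local Notation fct := (Vtilde R[i] l -> R[i]).

Definition complexify (x : Vtilde R l) : Vtilde R[i] l :=
  (map_mx (real_complex R) x.1.1, x.1.2%:C, x.2%:C).

Definition phase (m : ('I_l -> int) * int * int) (x : Vtilde R[i] l) : R[i] :=
  \sum_j (m.1.1 j)%:~R * x.1.1 0 j
  + (m.1.2%:~R * x.1.2 + m.2%:~R * x.2) / l.+1%:R.

Definition Fourier_polynomial (f : fct) : Prop :=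
  exists s : seq (R[i] * (('I_l -> int) * int * int)),
    forall x, f x = \sum_(t <- s) t.1 * e2pi (phase t.2 x).

Definition Wtilde_invariant (k : nat) (f : fct) : Prop :=
  forall g, Wtilde k g ->
  forall x : Vtilde R l, f (complexify (g x)) = f (complexify x).

(* x0 + i tau (- omega_r, a, b) *)
Definition ray (r : nat) (a b : R) (x0 : Vtilde R l) (tau : R) :
    Vtilde R[i] l :=
  let it := 0 +i* tau in let x := complexify x0 in
  (x.1.1 - it *: map_mx (real_complex R) (coords (omega R l r)),
   x.1.2 + it * a%:C, x.2 + it * b%:C).

Definition bounded_along (r : nat) (a b : R) (f : fct) : Prop :=
  forall x0 : Vtilde R l, exists M : R,
    \forall tau \near +oo, `|f (ray r a b x0 tau)| <= M%:C.

Definition inA (k : nat) (f : fct) : Prop :=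
  [/\ Fourier_polynomial f, Wtilde_invariant k f,
      bounded_along k 1 0 f & bounded_along k.+1 0 1 f].

Definition A_pred (k : nat) : {pred fct} := fun f => `[< inA k f >].

Definition d_ (j r : nat) : R := inner (omega R l j) (omega R l r).

Definition y_ (j : nat) (x : 'rV[R[i]]_l) : R[i] :=
  meval (fun s => e2pi (vec x 0 s)) (mesym l.+1 R[i] j).

Definition ytilde (k j : nat) (x : Vtilde R[i] l) : R[i] :=
  if (j <= l)%N then
    e2pi ((d_ j k)%:C * x.1.2 + (d_ j k.+1)%:C * x.2) * y_ j x.1.1
  else if j == l.+1 then e2pi x.1.2
  else e2pi x.2.

Lemma phaseD m n x :
  phase (fun j => m.1.1 j + n.1.1 j, m.1.2 + n.1.2, m.2 + n.2) x =
  phase m x + phase n x.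
Proof.
rewrite /phase /= addrACA -mulrDl -big_split /=; congr (_ + _ / _).
  by apply: eq_bigr => j _; rewrite intrD mulrDl.
by rewrite !intrD !mulrDl addrACA.
Qed.

Lemma phase0 x : phase (fun=> 0, 0, 0) x = 0.
Proof.
by rewrite /phase /= big1 => [|j _]; rewrite !mulr0z !mul0r // !addr0 mul0r addr0.
Qed.

Lemma Fourier_polynomial1 : Fourier_polynomial 1.
Proof.
exists [:: (1, (fun=> 0, 0, 0))] => x.
by rewrite big_seq1 phase0 e2pi0 mulr1.
Qed.

Lemma Fourier_polynomialB f g :
  Fourier_polynomial f -> Fourier_polynomial g -> Fourier_polynomial (f - g).
Proof.
move=> [s fE] [t gE]; exists (s ++ [seq (- u.1, u.2) | u <- t]) => x.
rewrite big_cat big_map -[LHS]/(f x - g x) fE gE -sumrN; congr (_ + _).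
by apply: eq_bigr => u _; rewrite mulNr.
Qed.

Lemma Fourier_polynomialM f g :
  Fourier_polynomial f -> Fourier_polynomial g -> Fourier_polynomial (f * g).
Proof.
move=> [s fE] [t gE].
exists [seq (u.1 * v.1, (fun j => u.2.1.1 j + v.2.1.1 j,
   u.2.1.2 + v.2.1.2, u.2.2 + v.2.2)) | u <- s, v <- t] => x.
rewrite -[LHS]/(f x * g x) fE gE big_allpairs_dep mulr_suml.
apply: eq_bigr => u _; rewrite mulr_sumr; apply: eq_bigr => v _.
by rewrite phaseD e2piD mulrACA.
Qed.

Lemma bounded_along1 r a b : bounded_along r a b 1.
Proof.
by move=> x0; exists 1; near=> tau; rewrite normr1.
Unshelve. all: by end_near. Qed.

Lemma bounded_alongB r a b f g :
  bounded_along r a b f -> bounded_along r a b g -> bounded_along r a b (f - g).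
Proof.
move=> bf bg x0; have [M fM] := bf x0; have [N gN] := bg x0.
exists (M + N); near=> tau; rewrite rmorphD.
apply: (le_trans (ler_normB _ _)); apply: lerD.
  by near: tau.
by near: tau.
Unshelve. all: by end_near. Qed.

Lemma bounded_alongM r a b f g :
  bounded_along r a b f -> bounded_along r a b g -> bounded_along r a b (f * g).
Proof.
move=> bf bg x0; have [M fM] := bf x0; have [N gN] := bg x0.
exists (M * N); near=> tau; rewrite rmorphM -[X in `|X|]/(f _ * g _) normrM.
apply: ler_pM => //; by near: tau.
Unshelve. all: by end_near. Qed.

Fact A_subring_closed (k : nat) : subring_closed (A_pred k).
Proof.
split.
- apply/asboolP; split; [exact: Fourier_polynomial1|by []| |];
    exact: bounded_along1.
- move=> f g /asboolP[Ff If f1 f2] /asboolP[Fg Ig g1 g2]; apply/asboolP.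
  split; [exact: Fourier_polynomialB| |exact: bounded_alongB|
    exact: bounded_alongB].
  by move=> h hW x; rewrite -[LHS]/(f _ - g _) If // Ig.
move=> f g /asboolP[Ff If f1 f2] /asboolP[Fg Ig g1 g2]; apply/asboolP.
split; [exact: Fourier_polynomialM| |exact: bounded_alongM|
  exact: bounded_alongM].
by move=> h hW x; rewrite -[LHS]/(f _ * g _) If // Ig.
Qed.

HB.instance Definition _ (k : nat) :=
  GRing.isSubringClosed.Build _ (A_pred k) (A_subring_closed k).

Record ringA (k : nat) : Type :=
  RingA { ringA_fun :> fct; _ : ringA_fun \in A_pred k }.

HB.instance Definition _ (k : nat) := [isSub for (@ringA_fun k)].
HB.instance Definition _ (k : nat) := [Choice of ringA k by <:].
HB.instance Definition _ (k : nat) :=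
  GRing.SubChoice_isSubComPzRing.Build _ _ (ringA k) (A_subring_closed k).

End InvariantFourierPolynomials.

(* Main.v *)
Require Import Defs.
From HB Require Import structures.
From mathcomp Require Import all_boot all_order all_algebra perm complex.
From mathcomp Require Import -(notations) mpoly.
From mathcomp Require Import boolp classical_sets functions reals topology.
From mathcomp Require Import normedtype sequences exp trigo.
From mathcomp Require Import ring lra zify.

Import Order.TTheory GRing.Theory Num.Theory.

(** Elements of the invariant ring are Fourier polynomials, hence finite
    combinations of characters.  Averaging f over the permutations turns each
    character into a symmetric polynomial in z_s = exp (2 pi i v_s) times an
    exponential in the central variables x_(l+1) and x_(l+2); by the
    fundamental theorem of symmetric polynomials and the relation
    y_(l+1) = z_1 ... z_(l+1) = 1, f becomes a polynomial in y_1, ..., y_l with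
    such exponentials as coefficients ([invariant_laurent]).  Since
    ytilde_j differs from y_j by an exponential in the central variables, f is
    also a polynomial in ytilde_1, ..., ytilde_l with central exponentials as
    coefficients.  The ytilde_j are invariant under the two translations, so
    that averaging over the translations leaves only integral powers of
    ytilde_(l+1) and ytilde_(l+2) ([laurent_sum_translate]).  Up to here f is
    a polynomial H in the generators, divided by powers of ytilde_(l+1) and
    ytilde_(l+2).

    The denominators are removed one factor at a time ([descent]).  Along ray
    (a) the generators are polynomials in the decaying quantity
    exp (- 2 pi tau), and ytilde_(l+1) is proportional to it
    ([ytilde_ray]).  If f is bounded and f ytilde_(l+1) ^ (M+1) = H (ytilde),
    then H vanishes at the limit values of the generators for every real base
    point, and by the identity principle for Fourier polynomials
    ([Fourier_eq0]) for every complex one.  These limit values fill the torus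
    in the hyperplane where the coordinate of ytilde_(l+1) is zero: for
    r = k they are determined by the elementary symmetric functions of
    z_1, ..., z_r on the one hand and of z_(r+1), ..., z_(l+1) on the other,
    which can be prescribed over an algebraically closed field
    ([raypoly0_surj]).  Hence H is divisible by the variable of
    ytilde_(l+1), and M decreases.  Ray (b) deals with ytilde_(l+2) in the
    same way, with r = k+1.

    The same divisibility, for f = 0, shows that the generators are
    algebraically independent ([ytilde_alg_indep]): a relation of minimal
    degree would be divisible by a variable, and the quotient would again be a
    relation.  Conversely the generators belong to the ring because y_j grows
    along the ray of omega_r at most like exp (2 pi tau (omega_j, omega_r)),
    which the prefactor of ytilde_j compensates. *)

Local Open Scope ring_scope.
Local Open Scope complex_scope.
Set Implicit Arguments.
Unset Strict Implicit.
Unset Printing Implicit Defensive.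

(** * Polynomial identities *)

Lemma poly_eq0_inj_roots (K : idomainType) (p : {poly K}) (f : nat -> K) :
  injective f -> (forall n, p.[f n] = 0) -> p = 0.
Proof.
move=> f_inj pf0; apply/eqP/negP => /negP p0.
have := @max_poly_roots _ p [seq f n | n <- iota 0 (size p)] p0.
rewrite map_inj_uniq // iota_uniq size_map size_iota ltnn => /(_ _ isT) H.
suff: false by []; apply: H; apply/allP => _ /mapP[n _ ->].
by rewrite /root pf0.
Qed.

Lemma radix_inj (n N : nat) (a b : 'I_n -> nat) :
  (forall i, (a i < N)%N) -> (forall i, (b i < N)%N) ->
  (\sum_i a i * N ^ i = \sum_i b i * N ^ i)%N -> a =1 b.
Proof.
elim: n a b => [|n IHn] a b aN bN; first by move=> _ [].
rewrite !big_ord_recl !expn0 !muln1.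
have E c : (\sum_(i < n) c (lift ord0 i) * N ^ bump 0 i =
    (\sum_(i < n) c (lift ord0 i) * N ^ i) * N)%N.
  by rewrite big_distrl; apply: eq_bigr => i _; rewrite /bump add1n expnSr mulnA.
rewrite !E => eq_ab.
have ab0 : a ord0 = b ord0.
  have := congr1 (modn^~ N) eq_ab.
  by rewrite ![(_ + _ * N)%N]addnC !modnMDl !modn_small.
move: eq_ab; rewrite ab0 => /addnI /eqP.
rewrite eqn_pmul2r ?(leq_ltn_trans _ (aN ord0)) // => /eqP /IHn eq_lift i.
case: (unliftP ord0 i) => [j|] -> //.
by apply: eq_lift => t; rewrite ?aN ?bN.
Qed.

(** Lets each closure property (Fourier polynomials, elements of the invariant
    ring, Laurent expressions) be checked on constants, sums, products and
    generators only. *)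
Lemma meval_closure (T : Type) (K : comNzRingType) n (P : (T -> K) -> Prop)
    (g : 'I_n -> T -> K) :
  (forall c, P (fun=> c)) ->
  (forall f h, P f -> P h -> P (fun x => f x + h x)) ->
  (forall f h, P f -> P h -> P (fun x => f x * h x)) ->
  (forall i, P (g i)) ->
  forall p : mpoly n K, P (fun x => meval (fun i => g i x) p).
Proof.
move=> Pc PD PM Pg p.
have PX i m : P (fun x => g i x ^+ m).
  elim: m => [|m IHm]; first exact: Pc.
  suff -> : (fun x => g i x ^+ m.+1) = (fun x => g i x * g i x ^+ m) by exact: PM.
  by apply/funext => x; rewrite exprS.
have Pprod (m : multinom n) (r : seq 'I_n) : P (fun x => \prod_(i <- r) g i x ^+ m i).
  elim: r => [|i r IHr].
    suff -> : (fun x => \prod_(i <- [::]) g i x ^+ m i) = (fun=> 1) by exact: Pc.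
    by apply/funext => x; rewrite big_nil.
  suff -> : (fun x => \prod_(j <- i :: r) g j x ^+ m j) =
      (fun x => g i x ^+ m i * \prod_(j <- r) g j x ^+ m j) by exact: PM.
  by apply/funext => x; rewrite big_cons.
suff Psum (s : seq (multinom n)) :
    P (fun x => \sum_(m <- s) mcoeff m p * \prod_i g i x ^+ m i).
  exact: (Psum (msupp p)).
elim: s => [|m s IHs].
  suff -> : (fun x => \sum_(m <- [::]) mcoeff m p * \prod_i g i x ^+ m i) =
      (fun=> 0) by exact: Pc.
  by apply/funext => x; rewrite big_nil.
suff -> : (fun x => \sum_(j <- m :: s) mcoeff j p * \prod_i g i x ^+ j i) =
    (fun x => (fun=> mcoeff m p) x * \prod_i g i x ^+ m i +
       \sum_(j <- s) mcoeff j p * \prod_i g i x ^+ j i).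
  by apply: (PD _ _ (PM _ _ (Pc _) (Pprod _ _)) IHs).
by apply/funext => x; rewrite big_cons.
Qed.

Lemma horner_meval (K : comNzRingType) n (g : 'I_n -> {poly K}) (p : mpoly n K) :
  exists h : {poly K}, forall t, h.[t] = meval (fun i => (g i).[t]) p.
Proof.
exists (\sum_(m <- msupp p) mcoeff m p *: \prod_i g i ^+ m i) => t.
rewrite mevalE horner_sum; apply: eq_bigr => m _.
rewrite hornerZ horner_prod; congr (_ * _); apply: eq_bigr => i _.
by rewrite horner_exp.
Qed.

(** Kronecker substitution: evaluating at c_i = t ^ (N ^ i) turns distinct
    monomials of degree < N into distinct powers of t, so that a polynomial
    vanishing on the torus gives a univariate one with infinitely many roots. *)
Lemma mpoly_eq0_torus (K : numFieldType) n (p : mpoly n K) :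
  (forall c : 'I_n -> K, (forall i, c i != 0) -> meval c p = 0) -> p = 0.
Proof.
move=> p0.
(* The digits of kappa m in base N are the exponents of m. *)
pose N := msize p.
pose kappa (m : multinom n) := (\sum_(i < n) m i * N ^ i)%N.
have kappa_inj : {in msupp p &, injective kappa}.
  move=> m m' mp m'p /radix_inj E; apply/mnmP; apply: E => i.
    by apply: leq_ltn_trans (msize_mdeg_lt mp); rewrite mdegE (bigD1 i) ?leq_addr.
  by apply: leq_ltn_trans (msize_mdeg_lt m'p); rewrite mdegE (bigD1 i) ?leq_addr.
pose q : {poly K} := \sum_(m <- msupp p) mcoeff m p *: 'X^(kappa m).
have q0 : q = 0.
  apply: (@poly_eq0_inj_roots _ _ (fun j => j.+1%:R)).
    by move=> i j /eqP; rewrite eqr_nat eqSS => /eqP.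
  move=> j; rewrite -[RHS](p0 (fun i => j.+1%:R ^+ (N ^ i)%N)); last first.
    by move=> i; rewrite expf_neq0 // pnatr_eq0.
  rewrite mevalE horner_sum; apply: eq_bigr => m _.
  rewrite !hornerE; congr (_ * _).
  rewrite -prodrXr; apply: eq_bigr => i _.
  by rewrite -exprM mulnC.
apply/mpolyP => m; rewrite mcoeff0.
case: (boolP (m \in msupp p)) => [mp|]; last by rewrite -mcoeff_eq0 => /eqP.
have := congr1 (fun r : {poly K} => r`_(kappa m)) q0.
rewrite /q coef0 coef_sum (bigD1_seq m) ?msupp_uniq //= coefZ coefXn eqxx mulr1.
rewrite big_seq_cond big1 ?addr0 // => m' /andP[m'p ne].
rewrite coefZ coefXn; case: eqP => [E|]; last by rewrite mulr0.
by move: ne; rewrite (kappa_inj m m') // eqxx.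
Qed.

Lemma mpoly_split_var (K : numFieldType) n (e : 'I_n) (p : mpoly n K) :
  exists q r, p = mpolyX K (mnm1 e) * q + r /\
    forall c c' : 'I_n -> K, (forall i, i != e -> c i = c' i) ->
      meval c r = meval c' r.
Proof.
pose hi := [seq m : multinom n <- msupp p | (0 < m e)%N].
pose lo := [seq m : multinom n <- msupp p | m e == 0%N].
exists (\sum_(m <- hi) mcoeff m p *: mpolyX K (mnm_sub m (mnm1 e))).
exists (\sum_(m <- lo) mcoeff m p *: mpolyX K m); split.
  rewrite {1}[p]mpolyE (bigID (fun m : multinom n => (0 < m e)%N)) /=.
  rewrite !big_filter mulr_sumr; congr (_ + _); last first.
    by apply: eq_bigl => m; rewrite -eqn0Ngt.
  apply: eq_bigr => m me; rewrite -scalerAr -mpolyXD; congr (_ *: mpolyX _ _).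
  apply/mnmP => i; rewrite mnmDE mnmBE mnm1E.
  by case: eqP => [<-|_] /=; rewrite ?add0n ?subn0 // subnKC.
move=> c c' cc'; rewrite !raddf_sum /= !big_filter; apply: eq_bigr => m /eqP me.
rewrite !mevalZ !mevalX; congr (_ * _); apply: eq_bigr => i _.
by have [->|/cc'->//] := eqVneq i e; rewrite me !expr0.
Qed.

(** A polynomial that vanishes on a dense subset of the hyperplane c_e = 0 is
    divisible by the variable of index e: the part free of that variable does
    not see c_e and hence vanishes on the whole torus. *)
Lemma mpoly_factor_var (K : numFieldType) n (e : 'I_n) (p : mpoly n K) :
  (forall c : 'I_n -> K, c e = 0 -> (forall i, i != e -> c i != 0) ->
     meval c p = 0) ->
  exists q, p = mpolyX K (mnm1 e) * q.
Proof.
have [q [r [-> rE]]] := mpoly_split_var e p => p0; exists q.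
suff -> : r = 0 by rewrite addr0.
apply: mpoly_eq0_torus => c c0.
rewrite (@rE _ (fun i => if i == e then 0 else c i)) => [|i /negPf-> //].
have := p0 (fun i => if i == e then 0 else c i); rewrite eqxx.
rewrite mevalD mevalM mevalXU eqxx mul0r add0r; apply => // i /negPf-> //.
Qed.

(** * Elementary symmetric functions *)

(** Working with the generating product instead of sums over subsets makes
    the factorization of the limits along a ray a mere product of
    polynomials. *)
Lemma coef_prod_1DX (K : comNzRingType) n (z : 'I_n -> K) j :
  (\prod_i (1 + z i *: 'X))`_j = meval z (mesym n K j).
Proof.
under eq_bigr do rewrite addrC.
rewrite bigA_distr coef_sum /mesym raddf_sum /= [RHS]big_mkcond /=.
apply: eq_bigr => J _.
have -> : \prod_i (if i \in J then z i *: 'X else 1) =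
    (\prod_(i in J) z i) *: 'X^#|J|.
  rewrite -big_mkcond /=.
  by rewrite -sum1_card -prodrXr -scaler_prod.
rewrite coefZ coefXn rmorph_prod eq_sym /=.
case: eqP => _; rewrite ?mulr0 // mulr1.
by apply: eq_bigr => i _; rewrite mevalXU.
Qed.

Lemma coef_comp_scaleX (K : comNzRingType) (c : K) (p : {poly K}) i :
  (p \Po (c *: 'X))`_i = c ^+ i * p`_i.
Proof.
rewrite comp_polyE coef_sum.
under eq_bigr do rewrite exprZn coefZ coefZ coefXn.
have [ip|ip] := ltnP i (size p).
  rewrite (bigD1 (Ordinal ip)) //= eqxx mulr1 mulrC big1 ?addr0 // => j.
  by rewrite -val_eqE /= eq_sym => /negPf->; rewrite !mulr0.
rewrite [p`_i]nth_default // mulr0 big1 // => j _.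
by rewrite gtn_eqF ?(leq_trans (ltn_ord j)) // !mulr0.
Qed.

(** Rescaling all the z_s amounts to rescaling the formal variable. *)
Lemma coef_prod_1DX_scale (K : comNzRingType) (I : finType) (P : pred I)
    (c : K) (z : I -> K) i :
  (\prod_(s | P s) (1 + (z s * c) *: 'X))`_i =
  c ^+ i * (\prod_(s | P s) (1 + z s *: 'X))`_i.
Proof.
rewrite -coef_comp_scaleX; congr (nth 0 (polyseq _) i).
rewrite rmorph_prod /=; apply: eq_bigr => s _.
by rewrite rmorphD rmorph1 /= comp_polyZ comp_polyX scalerA.
Qed.

Lemma size_prod_1DX (K : idomainType) (I : finType) (P : pred I) (z : I -> K) :
  (size (\prod_(s | P s) (1 + z s *: 'X))%R <= #|P|.+1)%N.
Proof.
rewrite -sum1_card; elim/big_rec2: _ => [|s n p _ IH].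
  by rewrite size_poly1.
apply: leq_trans (size_polyMleq _ _) _.
have : (size (1 + z s *: 'X)%R <= 2)%N.
  rewrite (leq_trans (size_polyD _ _)) // size_poly1 geq_max /=.
  by rewrite (leq_trans (size_scale_leq _ _)) // size_polyX.
by move: IH; set u := size p; set v := size _; lia.
Qed.

Lemma card_ord_lt n r : (r <= n)%N -> #|[pred s : 'I_n | (s < r)%N]| = r.
Proof.
move=> rn; rewrite -sum1_card /= (eq_bigl (fun s : 'I_n => (s < r)%N)) //.
by rewrite -(big_ord_widen n (fun=> 1%N)) // sum1_card card_ord.
Qed.

(** The orbit sum is the value of a symmetric polynomial, to which the
    fundamental theorem of symmetric polynomials applies. *)
Lemma sym_orbit_sum (K : idomainType) n (p : mpoly n K) :
  exists q : mpoly n K, forall z : 'I_n -> K,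
    \sum_(w : 'S_n) meval (fun s => z (w s)) p =
    meval (fun i : 'I_n => meval z (mesym n K i.+1)) q.
Proof.
have msym_eval z (w : 'S_n) : meval (fun s => z (w s)) p = meval z (msym w p).
  rewrite mevalE /msym /mmap raddf_sum; apply: eq_bigr => m _.
  rewrite /= mevalM mevalC; congr (_ * _).
  rewrite /mmap1 rmorph_prod; apply: eq_bigr => i _.
  by rewrite rmorphXn /= mevalXU.
have [|q [qE _]] := @sym_fundamental n K (\sum_(w : 'S_n) msym w p).
  apply/issymP => u; rewrite raddf_sum /= [RHS](reindex_inj (mulIg u)).
  by apply: eq_bigr => w _; rewrite msymMm.
exists q => z; transitivity (meval z (\sum_(w : 'S_n) msym w p)).
  by rewrite raddf_sum; apply: eq_bigr => w _; apply: msym_eval.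
rewrite -qE comp_mpoly_meval; apply: meval_eq => i.
by rewrite tnth_mktuple.
Qed.

(** Over an algebraically closed field the elementary symmetric functions of
    n nonzero numbers take arbitrary values, except that the last one is
    nonzero: the z_i are minus the inverses of the roots. *)
Lemma split_1DX (K : closedFieldType) n (p : {poly K}) :
  p`_0 = 1 -> size p = n.+1 ->
  exists z : nat -> K, [/\ forall i, z i != 0,
    p = \prod_(i < n) (1 + z i *: 'X) & \prod_(i < n) z i = p`_n].
Proof.
move=> p0 sp; have [r pE] := closed_field_poly_normal p.
have lead0 : lead_coef p != 0 by rewrite lead_coef_eq0 -size_poly_eq0 sp.
have size_r : size r = n.
  by apply: succn_inj; rewrite -sp pE size_scale // size_prod_XsubC.
have lead_r : lead_coef p * \prod_(x <- r) (- x) = 1.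
  have := congr1 (horner^~ 0) pE.
  rewrite /= hornerZ horner_prod horner_coef0 p0 => p00; apply/esym.
  rewrite [LHS]p00; congr (_ * _).
  by apply: eq_bigr => x _; rewrite !hornerE.
have r_neq0 x : x \in r -> x != 0.
  move=> xr; apply/eqP => x0; move/eqP: lead_r.
  by rewrite (big_rem x xr) /= x0 oppr0 mul0r mulr0 eq_sym oner_eq0.
exists (fun i => - (nth 1 r i)^-1); split.
- move=> i; rewrite oppr_eq0 invr_eq0.
  have [ir|ir] := ltnP i (size r); last by rewrite nth_default ?oner_neq0.
  by rewrite r_neq0 ?mem_nth.
- rewrite -size_r -(big_mkord xpredT (fun i => 1 + (- (nth 1 r i)^-1) *: 'X)).
  rewrite -(big_nth 1 xpredT (fun x => 1 + (- x^-1) *: 'X)) {1}pE.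
  rewrite -[RHS]scale1r -lead_r -scalerA -scaler_prod; congr (_ *: _).
  apply: eq_big_seq => x xr.
  by rewrite scalerDr scalerA mulrNN divff ?r_neq0 // scale1r addrC alg_polyC polyCN.
rewrite -size_r -(big_mkord xpredT (fun i => - (nth 1 r i)^-1)).
rewrite -(big_nth 1 xpredT (fun x => - x^-1)) size_r.
have -> : p`_n = lead_coef p by rewrite lead_coefE sp.
apply: (mulfI (x := \prod_(x <- r) (- x))).
  by move/eqP: lead_r; apply: contraTneq => ->; rewrite mulr0 eq_sym oner_eq0.
rewrite [RHS]mulrC lead_r -big_split /= big1_seq // => x /andP[_ xr].
by rewrite mulrNN divff ?r_neq0.
Qed.

(** * The complex exponential *)

Section ComplexExponentialTheory.
Variable R : realType.
Local Notation C := R[i].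

Lemma e2piE (a b : R) :
  e2pi (a +i* b) = (expR (- (2 * pi * b)))%:C *
    (cos (2 * pi * a) +i* sin (2 * pi * a)).
Proof. by rewrite /e2pi /cexp /= !mul0r sub0r add0r. Qed.

Lemma e2pi_neq0 (z : C) : e2pi z != 0.
Proof.
have z0 : e2pi z * e2pi (- z) = 1 by rewrite -e2piD subrr e2pi0.
by apply/eqP => E; move/eqP: z0; rewrite E mul0r eq_sym oner_eq0.
Qed.

Lemma e2piN (z : C) : e2pi (- z) = (e2pi z)^-1.
Proof.
apply: (mulfI (e2pi_neq0 z)).
by rewrite -e2piD subrr e2pi0 divff ?e2pi_neq0.
Qed.

Lemma e2pi_sum (I : Type) (r : seq I) (P : pred I) (F : I -> C) :
  e2pi (\sum_(i <- r | P i) F i) = \prod_(i <- r | P i) e2pi (F i).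
Proof. exact: (big_morph _ (@e2piD R) (@e2pi0 R)). Qed.

Lemma e2piMn (z : C) n : e2pi (n%:R * z) = e2pi z ^+ n.
Proof.
rewrite mulr_natl; elim: n => [|n IHn]; first by rewrite mulr0n e2pi0.
by rewrite mulrS e2piD IHn exprS.
Qed.

Lemma e2pi_nat n : e2pi (n%:R : C) = 1.
Proof.
rewrite -[n%:R]mulr1 e2piMn (_ : e2pi 1 = 1) ?expr1n //.
rewrite -[1]/(1%:C) -complexr0 e2piE mulr0 oppr0 expR0 mulr1.
by rewrite mulr_natl cos2pi sin2pi mulr1.
Qed.

Lemma e2pi_int (m : int) : e2pi (m%:~R : C) = 1.
Proof.
by case: m => n; rewrite ?NegzE ?mulrNz ?e2piN e2pi_nat ?invr1.
Qed.

Lemma e2pi_itau (tau a : R) :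
  e2pi ((0 +i* tau) * a%:C) = (expR (- (2 * pi * (tau * a))))%:C.
Proof.
rewrite (_ : _ * _ = 0 +i* (tau * a)); last first.
  by apply/eqP; rewrite eq_complex /= !mul0r !mulr0 subr0 add0r !eqxx.
by rewrite e2piE mulr0 cos0 sin0 mulr1.
Qed.

Lemma e2pi_surj (c : C) : c != 0 -> exists z, e2pi z = c.
Proof.
move=> c0.
have [r r0 rE] : exists2 r : R, 0 < r & `|c| = r%:C.
  exists (complex.Re `|c|); last by rewrite RRe_real ?normr_real.
  by rewrite -ltcR RRe_real ?normr_real ?normr_gt0.
have [a [b [cE ab1]]] : exists a b : R, c = r%:C * (a +i* b) /\ a ^+ 2 + b ^+ 2 = 1.
  have rn0 := lt0r_neq0 r0.
  exists (complex.Re c / r), (complex.Im c / r); split.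
    case: c rE {c0} => x y _; apply/eqP; rewrite eq_complex /= !mul0r subr0 addr0.
    by rewrite !mulrA ![r * _]mulrC !mulfK ?eqxx.
  have := add_Re2_Im2 c; rewrite rE -rmorphXn => /complexI H.
  by rewrite !expr_div_n -mulrDl H divff // expf_neq0.
have a1 : -1 <= a <= 1 by nra.
have [t [cost sint]] : exists t : R, cos t = a /\ sin t = b.
  have sq : Num.sqrt (1 - a ^+ 2) = `|b|.
    by rewrite -ab1 addrAC subrr add0r sqrtr_sqr.
  have [b0|b0] := leP 0 b.
    by exists (acos a); rewrite acosK // sin_acos // sq ger0_norm.
  exists (- acos a); rewrite cosN sinN acosK // sin_acos // sq ltr0_norm //.
  by rewrite opprK.
have pi0 : 2 * pi != 0 :> R by rewrite mulf_neq0 // gt_eqF // pi_gt0.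
exists ((t / (2 * pi)) +i* (- (ln r / (2 * pi)))).
rewrite e2piE mulrN opprK ![2 * pi * _]mulrC !divfK // lnK ?posrE //.
by rewrite cost sint cE.
Qed.

(** Infinitely many distinct points on the unit circle, all images of real
    numbers; the angles 2 pi / (n + 2) lie in ]0, pi], where cos is
    injective. *)
Lemma e2pi_inv_inj : injective (fun n => e2pi (n.+2%:R^-1 : R)%:C).
Proof.
move=> m n; rewrite -!complexr0 !e2piE !mulr0 oppr0 expR0 !mul1r.
move=> /eqP; rewrite eq_complex /= => /andP[/eqP E _].
have itv (j : nat) : 2 * pi / j.+2%:R \in `[0, pi : R].
  rewrite in_itv /=; have := pi_gt0 R => pi0.
  rewrite divr_ge0 ?mulr_ge0 ?pi_ge0 //= ler_pdivrMr // mulrC.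
  by rewrite ler_pM2l // ler_nat.
have := cos_inj (itv m) (itv n) E.
have : 2 * pi != 0 :> R by rewrite mulf_neq0 // gt_eqF // pi_gt0.
by move=> /mulfI /[apply] /invr_inj/eqP; rewrite eqr_nat !eqSS => /eqP.
Qed.

(** The remainder r of p modulo n satisfies cos (2 pi r / n) = 1.  Since cos is
    injective on [0, pi] only, r is replaced by n - r when 2 r > n. *)
Lemma e2pi_eq1 (p : int) n : (0 < n)%N ->
  e2pi ((p%:~R / n%:R : R)%:C) = 1 -> (n %| p)%Z.
Proof.
move=> n0 e1; apply/dvdz_mod0P.
have nR : 0 < n%:R :> R by rewrite ltr0n.
have pi0 := pi_gt0 R.
have small (r : nat) : (2 * r <= n)%N -> e2pi ((r%:R / n%:R : R)%:C) = 1 -> r = 0%N.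
  move=> rn; rewrite -complexr0 e2piE mulr0 oppr0 expR0 mul1r => /eqP.
  rewrite eq_complex /= => /andP[/eqP cos1 _].
  have itv0 : (0 : R) \in `[0, pi : R] by rewrite in_itv /= lexx ltW.
  have itvr : 2 * pi * (r%:R / n%:R) \in `[0, pi : R].
    rewrite in_itv /= mulr_ge0 ?mulr_ge0 ?divr_ge0 ?pi_ge0 ?invr_ge0 ?ler0n //=.
    rewrite mulrA ler_pdivrMr // -mulrA mulrCA ler_pM2l //.
    by rewrite -natrM ler_nat.
  have /eqP := cos_inj itvr itv0 (etrans cos1 (esym (@cos0 R))).
  rewrite !mulf_eq0 invr_eq0 !pnatr_eq0 /=.
  by rewrite (gt_eqF pi0) (gtn_eqF n0) orbF => /eqP.
set r := (p %% n)%Z.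
have r0 : 0 <= r by apply: modz_ge0; rewrite eqz_nat -lt0n.
have rn : r < n%:Z by apply: ltz_pmod.
have pE : p = (p %/ n)%Z * n + r := divz_eq p n.
clearbody r.
have er : e2pi ((r%:~R / n%:R : R)%:C) = 1.
  rewrite -[RHS]e1 [in RHS]pE intrD intrM -pmulrn mulrDl mulfK ?gt_eqF //.
  by rewrite rmorphD e2piD rmorph_int e2pi_int mul1r.
case: r r0 rn er {pE} => // r _ rn er.
have [|nr] := leqP (2 * r) n; first by move=> /small/(_ er) ->.
suff : (n - r)%N = 0%N by move: rn; lia.
apply: small; first by lia.
rewrite natrB; last by lia.
by rewrite mulrBl divff ?gt_eqF // rmorphB rmorph1 e2piD e2piN er (e2pi_nat 1) invr1 mulr1.
Qed.

End ComplexExponentialTheory.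

(** * Fourier polynomials and their real values *)

Section FourierTheory.
Variables (R : realType) (l : nat).
Local Notation C := R[i].
Local Notation fct := (Vtilde C l -> C).

Lemma Fourier_const (c : C) : Fourier_polynomial (fun _ : Vtilde C l => c).
Proof.
exists [:: (c, (fun=> 0, 0, 0))] => x.
by rewrite big_seq1 phase0 e2pi0 mulr1.
Qed.

Lemma FourierD (f g : fct) : Fourier_polynomial f -> Fourier_polynomial g ->
  Fourier_polynomial (fun x => f x + g x).
Proof.
move=> [s fE] [t gE]; exists (s ++ t) => x.
by rewrite big_cat fE gE.
Qed.

Lemma FourierM (f g : fct) : Fourier_polynomial f -> Fourier_polynomial g ->
  Fourier_polynomial (fun x => f x * g x).
Proof. exact: Fourier_polynomialM. Qed.

(** Multiplied by a large power of u = e2pi z the sum becomes a polynomial in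
    u, which has infinitely many roots on the unit circle. *)
Lemma trig_poly_eq0 (s : seq (C * int)) :
  (forall t : R, \sum_(u <- s) u.1 * e2pi (u.2%:~R * t%:C) = 0) ->
  forall z : C, \sum_(u <- s) u.1 * e2pi (u.2%:~R * z) = 0.
Proof.
move=> s0 z; pose N := (\sum_(u <- s) absz u.2)%N.
pose q : {poly C} := \sum_(u <- s) u.1 *: 'X^(absz (u.2 + N%:Z)).
have qE w : q.[e2pi w] = e2pi (N%:R * w) * \sum_(u <- s) u.1 * e2pi (u.2%:~R * w).
  rewrite /q horner_sum mulr_sumr; apply: eq_big_seq => u us.
  rewrite hornerZ hornerXn mulrCA -e2piD -mulrDl -e2piMn; congr (_ * e2pi (_ * _)).
  have uN : (absz u.2 <= N)%N by rewrite /N (big_rem u us) leq_addr.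
  have N0 : 0 <= u.2 + N%:Z by lia.
  by rewrite -[LHS]/((absz (u.2 + N%:Z))%:~R) gez0_abs // intrD addrC.
have q0 : q = 0.
  apply: (poly_eq0_inj_roots (@e2pi_inv_inj R)) => n.
  by rewrite qE s0 mulr0.
have := qE z; rewrite q0 horner0 => /esym/eqP.
by rewrite mulf_eq0 (negPf (e2pi_neq0 _)) => /eqP.
Qed.

(** On a complex line X whose phases have integral slopes n m, a Fourier
    polynomial is a one-variable trigonometric polynomial. *)
Lemma Fourier_eq0_line (f : fct) (X : C -> Vtilde C l)
    (b : ('I_l -> int) * int * int -> C) n :
  (forall m z, phase m (X z) = b m + (n m)%:~R * z) ->
  Fourier_polynomial f -> (forall t : R, f (X t%:C) = 0) ->
  forall z, f (X z) = 0.
Proof.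
move=> phaseX [s fE] f0 z.
have fXE w : f (X w) =
    \sum_(u <- [seq (u.1 * e2pi (b u.2), n u.2) | u <- s]) u.1 * e2pi (u.2%:~R * w).
  by rewrite fE big_map; apply: eq_bigr => u _; rewrite phaseX e2piD mulrA.
by rewrite fXE; apply: trig_poly_eq0 => t; rewrite -fXE.
Qed.

(** Identity principle: the coordinates are released from the real axis one at
    a time.  Invariance is only given on the real space and the base points
    of the limits are real, whereas the solvability arguments need complex
    points. *)
Lemma Fourier_eq0 (f : fct) : Fourier_polynomial f ->
  (forall x, f (complexify x) = 0) -> forall x, f x = 0.
Proof.
move=> Ff f0.
have l0 : l.+1%:R != 0 :> C by rewrite pnatr_eq0.
have divE (s a c w : C) :
    s + (a * (l.+1%:R * w) + c) / l.+1%:R = s + c / l.+1%:R + a * w.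
  by rewrite mulrDl mulrCA [l.+1%:R * _]mulrC mulfK // [a * w + _]addrC addrA.
have f_row i (x : 'rV[C]_l) (a b : R) : (i <= l)%N ->
    (forall j : 'I_l, (i <= j)%N -> x 0 j \is Num.real) ->
    f (x, a%:C, b%:C) = 0.
  elim: i x => [|i IHi] x il xr.
    rewrite -(f0 (\row_j complex.Re (x 0 j), a, b)) /complexify /=.
    congr (f (_, _, _)); apply/rowP => j.
    by rewrite !mxE RRe_real // xr.
  pose X z : Vtilde C l :=
    (\row_j (if j == Ordinal il then z else x 0 j), a%:C, b%:C).
  have -> : (x, a%:C, b%:C) = X (x 0 (Ordinal il)).
    congr (_, _, _); apply/rowP => j; rewrite mxE.
    by case: eqP => [->|].
  apply: (@Fourier_eq0_line f X
    (fun m => \sum_(j | j != Ordinal il) (m.1.1 j)%:~R * x 0 j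
              + (m.1.2%:~R * a%:C + m.2%:~R * b%:C) / l.+1%:R)
    (fun m => m.1.1 (Ordinal il))) => //.
    move=> m z; rewrite /phase /= (bigD1 (Ordinal il)) //= mxE eqxx.
    rewrite [RHS]addrC [RHS]addrA; congr (_ + _ + _).
    by apply: eq_bigr => j /negPf jN; rewrite mxE jN.
  move=> t; apply: IHi; first exact: ltnW.
  move=> j ij; rewrite mxE; case: eqP => [_|/eqP jN].
    by apply/complex_realP; exists t.
  by apply: xr; rewrite ltn_neqAle ij andbT; rewrite -val_eqE /= eq_sym in jN.
have f_1 x z (b : R) : f (x, z, b%:C) = 0.
  have -> : z = l.+1%:R * (z / l.+1%:R) by rewrite mulrC divfK.
  apply: (@Fourier_eq0_line f (fun z => (x, l.+1%:R * z, b%:C))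
    (fun m => \sum_j (m.1.1 j)%:~R * x 0 j + (m.2%:~R * b%:C) / l.+1%:R)
    (fun m => m.1.2)) => //.
    by move=> m w; rewrite /phase /= divE.
  move=> t; have -> : l.+1%:R * t%:C = (l.+1%:R * t)%:C.
    by rewrite rmorphM rmorph_nat.
  by apply: (f_row l) => // j; rewrite leqNgt ltn_ord.
case=> [[x z] w].
have -> : w = l.+1%:R * (w / l.+1%:R) by rewrite mulrC divfK.
apply: (@Fourier_eq0_line f (fun w => (x, z, l.+1%:R * w))
  (fun m => \sum_j (m.1.1 j)%:~R * x 0 j + (m.1.2%:~R * z) / l.+1%:R)
  (fun m => m.2)) => //.
  by move=> m t; rewrite /phase /= [m.1.2%:~R * _ + _]addrC divE.
move=> t; have -> : l.+1%:R * t%:C = (l.+1%:R * t)%:C.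
  by rewrite rmorphM rmorph_nat.
exact: f_1.
Qed.

Lemma Fourier_eq (f g : fct) : Fourier_polynomial f -> Fourier_polynomial g ->
  (forall x, f (complexify x) = g (complexify x)) -> forall x, f x = g x.
Proof.
move=> Ff Fg fg x; apply/eqP; rewrite -subr_eq0; apply/eqP.
apply: (Fourier_eq0 (Fourier_polynomialB Ff Fg)) => {}x.
by rewrite -[LHS]/(f _ - g _) fg subrr.
Qed.

End FourierTheory.

(** * Fundamental weights in coordinates *)

Section WeightCombinatorics.
Variables (R : realType) (l : nat).
Local Notation C := R[i].

Lemma vecD (F : numFieldType) (x y : 'rV[F]_l) : vec (x + y) = vec x + vec y.
Proof.
by rewrite /vec -big_split; apply: eq_bigr => j _; rewrite mxE scalerDl.
Qed.

Lemma vecZ (F : numFieldType) c (x : 'rV[F]_l) : vec (c *: x) = c *: vec x.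
Proof.
by rewrite /vec scaler_sumr; apply: eq_bigr => j _; rewrite mxE scalerA.
Qed.

Lemma vec_map (x : 'rV[R]_l) :
  vec (map_mx (real_complex R) x) = map_mx (real_complex R) (vec x).
Proof.
apply/rowP => s; rewrite mxE !vecE rmorph_sum; apply: eq_bigr => j _.
by rewrite mxE rmorphM rmorphB !rmorph_nat.
Qed.

Lemma sum_lt n r : (r <= n)%N -> \sum_(s < n) (s < r)%N%:R = r%:R :> R.
Proof.
move=> rn; rewrite -natr_sum; congr _%:R.
rewrite -[RHS](card_ord_lt rn) -sum1_card [RHS]big_mkcond /=.
by apply: eq_bigr => s _; rewrite inE; case: (s < r)%N.
Qed.

Lemma inV_add (F : numFieldType) (u v : 'rV[F]_l.+1) : inV u -> inV v -> inV (u + v).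
Proof.
move=> u0 v0; rewrite /inV; under eq_bigr do rewrite mxE.
by rewrite big_split /= u0 v0 addr0.
Qed.

Lemma omega_inV r : (r <= l.+1)%N -> inV (omega R l r).
Proof.
move=> rl; rewrite /inV; under eq_bigr do rewrite mxE.
rewrite sumrB sum_lt // sumr_const card_ord -[X in _ - X]mulr_natr.
by rewrite divfK ?pnatr_eq0 // subrr.
Qed.

Lemma d_min j r : (j <= l.+1)%N -> (r <= l.+1)%N ->
  d_ R l j r = (minn j r)%:R - (j * r)%:R / l.+1%:R.
Proof.
move=> jl rl; rewrite /d_ /inner.
have n0 : l.+1%:R != 0 :> R by rewrite pnatr_eq0.
transitivity (\sum_(s < l.+1) ((s < minn j r)%N%:R
   - (r%:R / l.+1%:R) * (s < j)%N%:R - (j%:R / l.+1%:R) * (s < r)%N%:R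
   + (j * r)%:R / l.+1%:R ^+ 2) : R).
  apply: eq_bigr => s _; rewrite !mxE leq_min natrM.
  move: (l.+1%:R : R) n0 => n n0.
  by case: (s < j)%N; case: (s < r)%N => /=; field.
rewrite big_split sumrB sumrB -!mulr_sumr !sum_lt ?geq_min ?jl //=.
rewrite sumr_const card_ord -[_ ^- 2 *+ _]mulr_natr natrM.
by move: (l.+1%:R : R) n0 => n n0; field.
Qed.

(** From here on y_j is read as a coefficient of the generating product over
    all the entries of vec x. *)
Lemma y_coef j (x : 'rV[C]_l) :
  y_ j x = (\prod_s (1 + e2pi (vec x 0 s) *: 'X))`_j.
Proof. by rewrite coef_prod_1DX. Qed.

Lemma prod_e2pi_vec (x : 'rV[C]_l) : \prod_s e2pi (vec x 0 s) = 1.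
Proof. by rewrite -e2pi_sum vec_inV e2pi0. Qed.

End WeightCombinatorics.

(** * Polynomials in a decaying exponential *)

Section RayLimits.
Variable R : realType.
Local Notation C := R[i].

(** The factor by which exp (2 pi i x_(l+1)) shrinks along ray (a), and
    exp (2 pi i x_(l+2)) along ray (b). *)
Definition decay (tau : R) : R := expR (- (2 * pi * tau)).

Lemma decay_small (d : R) : 0 < d -> \forall tau \near +oo, decay tau < d.
Proof.
move=> d0; near=> tau; rewrite /decay -(lnK (x := d)) ?posrE // ltr_expR.
have p0 : 0 < 2 * pi :> R by rewrite mulr_gt0 // pi_gt0.
rewrite ltrNl -ltr_pdivrMl //.
near: tau; apply: nbhs_pinfty_gt; exact: num_real.
Unshelve. all: by end_near. Qed.

Lemma horner_unit_bounded (p : {poly C}) :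
  exists2 M : R, 0 <= M &
    forall e : R, 0 <= e <= 1 -> `|p.[e%:C]| <= M%:C.
Proof.
pose M := \sum_(i < size p) `|p`_i|.
have M0 : 0 <= M by apply: sumr_ge0.
have ME : (complex.Re M)%:C = M by apply: RRe_real; apply: ger0_real.
exists (complex.Re M) => [|e /andP[e0 e1]]; first by rewrite -lecR ME.
rewrite ME horner_coef (le_trans (ler_norm_sum _ _ _)) //.
apply: ler_sum => i _; rewrite normrM -[X in _ <= X]mulr1 ler_wpM2l //.
by rewrite normrX ger0_norm ?ler0c // -rmorphXn lecR exprn_ile1.
Qed.

Lemma ray_poly_bounded (p : {poly C}) :
  exists M : R, \forall tau \near +oo, `|p.[(decay tau)%:C]| <= M%:C.
Proof.
have [M _ pM] := horner_unit_bounded p; exists M; near=> tau; apply: pM.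
rewrite expR_ge0 ltW //; near: tau; exact: decay_small.
Unshelve. all: by end_near. Qed.

(** Writing p = q X + p(0), both p(e) and e q(e) are O(e), hence so is the
    constant p(0). *)
Lemma ray_poly_vanish (p : {poly C}) (M : R) :
  (\forall tau \near +oo, `|p.[(decay tau)%:C]| <= (M * decay tau)%:C) ->
  p.[0] = 0.
Proof.
move=> pM; apply/eqP/negP => /negP p0.
have [q pE] : exists q, p = q * 'X + p.[0]%:P.
  have /factor_theorem[q qE] : root (p - p.[0]%:P) 0.
    by rewrite /root !hornerE subrr.
  by exists q; rewrite subr0 in qE; rewrite -qE subrK.
have [K K0 qK] := horner_unit_bounded q.
pose c := complex.Re `|p.[0]|.
have cE : c%:C = `|p.[0]| by apply: RRe_real; apply: normr_real.
have c0 : 0 < c by rewrite -ltcR cE normr_gt0.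
have MK : 0 < `|M| + K + 1 by rewrite ltr_wpDl // addr_ge0.
near (@pinfty_nbhs R) => tau.
set e := decay tau.
have e0 : 0 < e by apply: expR_gt0.
have e1 : e < 1 by rewrite /e; near: tau; exact: decay_small.
have e2 : e < c / (`|M| + K + 1).
  by rewrite /e; near: tau; apply: decay_small; rewrite divr_gt0.
have : `|p.[0]| <= (M * e + K * e)%:C.
  have -> : p.[0] = p.[e%:C] - q.[e%:C] * e%:C.
    by rewrite {2}pE !hornerE addrC addKr.
  rewrite (le_trans (ler_normB _ _)) // rmorphD lerD //.
    by rewrite /e; near: tau.
  rewrite normrM rmorphM [`|e%:C|]ger0_norm; last by rewrite ler0c ltW.
  by apply: ler_wpM2r; [rewrite ler0c ltW|apply: qK; rewrite !ltW].
rewrite -cE lecR => H.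
have : (`|M| + K + 1) * e < c by rewrite mulrC -ltr_pdivlMr.
have := ler_norm M; nra.
Unshelve. all: by end_near. Qed.

End RayLimits.

(** * The generators along the two rays *)

Section RayDegeneration.
Variables (R : realType) (l k : nat).
Hypothesis hkl : (k < l)%N.
Local Notation C := R[i].

(** The boolean a selects the ray: true for the direction of omega_k, which
    involves x_(l+1), and false for that of omega_(k+1), which involves
    x_(l+2). *)
Definition ray_weight (a : bool) : nat := if a then k else k.+1.

Lemma ray_weight_le a : (ray_weight a <= l)%N.
Proof. by case: a => //=; apply: ltnW. Qed.

Definition low r (x : 'rV[C]_l) : {poly C} :=
  \prod_(s < l.+1 | (s < r)%N) (1 + e2pi (vec x 0 s) *: 'X).

Definition high r (x : 'rV[C]_l) : {poly C} :=
  \prod_(s < l.+1 | ~~ (s < r)%N) (1 + e2pi (vec x 0 s) *: 'X).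

Definition prefactor j (x : Vtilde C l) : C :=
  e2pi ((d_ R l j k)%:C * x.1.2 + (d_ R l j k.+1)%:C * x.2).

(** The values of the j-th generator along a ray are the values of this
    polynomial at the decaying exponential.  On the entries s < r the ray in
    the direction of omega_r multiplies exp (2 pi i v_s) by an additional
    factor decay^(-1); choosing i of these entries costs decay^(-i), which
    the prefactor compensates by decay^(min j r).  The truncated subtraction
    is harmless, as the coefficient of index i of low r is 0 for i > r. *)
Definition raypoly (a : bool) j (x : Vtilde C l) : {poly C} :=
  let r := ray_weight a in
  if (j <= l)%N then
    prefactor j x *: \sum_(i < j.+1)
      ((low r x.1.1)`_i * (high r x.1.1)`_(j - i)) *: 'X^(minn j r - i)
  else if j == l.+1 then e2pi x.1.2 *: 'X^a
  else e2pi x.2 *: 'X^(~~ a).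

(** D is the factor common to all entries and E the additional one for
    the entries s < r; the powers of D cancel against the fractional part
    - j r / (l + 1) of (omega_j, omega_r). *)
Lemma ray_exponents (tau : R) i j r : (i <= j)%N -> (i <= r)%N ->
    (j <= l.+1)%N -> (r <= l.+1)%N ->
  let D := expR (- (2 * pi * (tau * (r%:R / l.+1%:R)))) in
  let E := expR (2 * pi * tau) in
  expR (- (2 * pi * (tau * d_ R l j r))) * ((D * E) ^+ i * D ^+ (j - i)) =
  expR (- (2 * pi * tau)) ^+ (minn j r - i).
Proof.
move=> ij ir jl rl /=; rewrite d_min // -!expRD -!expRM_natl -!expRD.
rewrite !natrB ?leq_min ?ij ?ir // natrM; congr expR.
have : l.+1%:R != 0 :> R by rewrite pnatr_eq0.
by move: (l.+1%:R : R) => n n0; field.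
Qed.

Lemma ytilde_ray a j (x0 : Vtilde R l) (tau : R) :
  ytilde k j (ray (ray_weight a) a%:R (~~ a)%:R x0 tau) =
  (raypoly a j (complexify x0)).[(decay tau)%:C].
Proof.
rewrite /decay.
have dE (b : bool) (u v t : C) :
    (d_ R l j k)%:C * (u + t * (b%:R)%:C) +
      (d_ R l j k.+1)%:C * (v + t * ((~~ b)%:R)%:C) =
    (d_ R l j k)%:C * u + (d_ R l j k.+1)%:C * v +
      t * (d_ R l j (ray_weight b))%:C.
  by case: b; rewrite /= rmorph0 rmorph1; ring.
set r := ray_weight a; set x := complexify x0.
set D := expR (- (2 * pi * (tau * (r%:R / l.+1%:R)))).
set E := expR (2 * pi * tau); set eps := expR (- (2 * pi * tau)).
have rl : (r <= l.+1)%N by apply/leqW/ray_weight_le.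
set x' := ray _ _ _ _ _.
have x1E : e2pi x'.1.2 = e2pi x.1.2 * (eps ^+ a)%:C.
  rewrite /x' /= e2piD e2pi_itau; congr (_ * _%:C).
  by rewrite /eps; case: (a); rewrite ?mulr1 ?mulr0 ?oppr0 ?expR0.
have x2E : e2pi x'.2 = e2pi x.2 * (eps ^+ ~~ a)%:C.
  rewrite /x' /= e2piD e2pi_itau; congr (_ * _%:C).
  by rewrite /eps; case: (a); rewrite ?mulr1 ?mulr0 ?oppr0 ?expR0.
rewrite /ytilde /raypoly; case: leqP => [jl|_]; last first.
  case: eqP => _; rewrite hornerZ hornerXn ?x1E ?x2E.
    by rewrite rmorphXn.
  by rewrite rmorphXn.
have prefE : e2pi ((d_ R l j k)%:C * x'.1.2 + (d_ R l j k.+1)%:C * x'.2) =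
    prefactor j x * (expR (- (2 * pi * (tau * d_ R l j r))))%:C.
  by rewrite -e2pi_itau -e2piD -dE.
rewrite prefE -mulrA hornerZ; congr (_ * _).
have zE s : e2pi (vec x'.1.1 0 s) =
    e2pi (vec x.1.1 0 s) * (D * (if (s < r)%N then E else 1))%:C.
  rewrite /x' /= vecD -scaleNr vecZ !vec_map coordsK; last exact: omega_inV.
  rewrite !mxE mulNr e2piD e2piN e2pi_itau; congr (_ * _).
  rewrite -rmorphV ?unitfE ?gt_eqF ?expR_gt0 // -expRN opprK; congr (_%:C).
  rewrite /D /E; case: (s < r)%N; rewrite ?mulr1 -?expRD; congr expR => /=; ring.
have lowE i : (low r x'.1.1)`_i = ((D * E) ^+ i)%:C * (low r x.1.1)`_i.
  rewrite rmorphXn /= -coef_prod_1DX_scale; congr (nth 0 (polyseq _) _).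
  by apply: eq_bigr => s sr; rewrite zE sr.
have highE i : (high r x'.1.1)`_i = (D ^+ i)%:C * (high r x.1.1)`_i.
  rewrite rmorphXn /= -coef_prod_1DX_scale; congr (nth 0 (polyseq _) _).
  by apply: eq_bigr => s /negPf sr; rewrite zE sr mulr1.
rewrite y_coef (bigID (fun s : 'I_l.+1 => (s < r)%N)) /= -/(low r x'.1.1).
rewrite -/(high r x'.1.1) coefM horner_sum mulr_sumr; apply: eq_bigr => i _.
rewrite hornerZ hornerXn lowE highE.
have [ir|ri] := leqP i r; last first.
  rewrite [(low r x.1.1)`_i]nth_default ?mulr0 ?mul0r ?mulr0 //.
  by rewrite (leq_trans (size_prod_1DX _ _)) // card_ord_lt.
have ij : (i <= j)%N by rewrite -ltnS.
rewrite -rmorphXn -ray_exponents ?(leqW jl) // !rmorphM /=.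
by rewrite -/D -/E; ring.
Qed.

End RayDegeneration.

(** * Characters as exponential monomials *)

Section Characters.
Variables (R : realType) (l : nat).
Local Notation C := R[i].
Local Notation V := (Vtilde C l).

Definition central (p q : int) (x : V) : C :=
  e2pi ((p%:~R * x.1.2 + q%:~R * x.2) / l.+1%:R).

Lemma centralD p q p' q' x :
  central (p + p') (q + q') x = central p q x * central p' q' x.
Proof.
by rewrite /central -e2piD; congr e2pi; rewrite !intrD; ring.
Qed.

Lemma central0 x : central 0 0 x = 1.
Proof. by rewrite /central !mul0r addr0 mul0r e2pi0. Qed.

(** Summation by parts rewrites sum m_j x_j as sum n_s v_s with
    n_s = sum_(j >= s) m_j.  As the v_s sum to zero, a constant N can be added
    to all the n_s to make the exponents nonnegative. *)
Lemma char_monomial (m : ('I_l -> int) * int * int) :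
  exists a : multinom l.+1, forall x : V, e2pi (phase m x) =
    meval (fun s => e2pi (vec x.1.1 0 s)) (mpolyX C a) * central m.1.2 m.2 x.
Proof.
pose n (s : 'I_l.+1) : int := \sum_(j < l | (s <= j)%N) m.1.1 j.
pose N := (\sum_s absz (n s))%N.
have nN s : 0 <= n s + N%:Z.
  suff : (absz (n s) <= N)%N by lia.
  by rewrite /N (bigD1 s) //= leq_addr.
exists (Multinom [tuple absz (n s + N%:Z) | s < l.+1]) => x.
rewrite /phase e2piD; congr (_ * _).
rewrite mevalX.
transitivity (e2pi (\sum_s (n s + N%:Z)%:~R * vec x.1.1 0 s)); last first.
  rewrite e2pi_sum; apply: eq_bigr => s _; rewrite mnmE -e2piMn.
  by rewrite -{1}[n s + N%:Z]gez0_abs // -pmulrn.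
congr e2pi.
under [RHS]eq_bigr do rewrite intrD mulrDl.
rewrite big_split /= -mulr_sumr.
have -> : \sum_s vec x.1.1 0 s = 0 by apply: vec_inV.
rewrite mulr0 addr0.
under [RHS]eq_bigr do rewrite /n rmorph_sum mulr_suml big_mkcond /=.
rewrite exchange_big /=; apply: eq_bigr => j _.
rewrite -{1}(vecK x.1.1) mxE mulr_sumr [LHS]big_mkcond /=.
by apply: eq_bigr => s _; case: ifP.
Qed.

End Characters.

(** * Closure properties of Fourier polynomials *)

Section FourierExamples.
Variables (R : realType) (l : nat).
Local Notation C := R[i].
Local Notation V := (Vtilde C l).

Lemma Fourier_sum n (F : 'I_n -> V -> C) :
  (forall i, Fourier_polynomial (F i)) ->
  Fourier_polynomial (fun x => \sum_i F i x).
Proof.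
move=> FF; suff H (r : seq 'I_n) : Fourier_polynomial (fun x => \sum_(i <- r) F i x).
  exact: H.
elim: r => [|i r IHr].
  suff -> : (fun x => \sum_(i <- [::]) F i x) = (fun=> 0) by exact: Fourier_const.
  by apply/funext => x; rewrite big_nil.
suff -> : (fun x => \sum_(j <- i :: r) F j x) =
    (fun x => F i x + \sum_(j <- r) F j x) by exact: FourierD.
by apply/funext => x; rewrite big_cons.
Qed.

Lemma Fourier_vec s : Fourier_polynomial (fun x : V => e2pi (vec x.1.1 0 s)).
Proof.
exists [:: (1, (fun j : 'I_l => (s == j :> nat)%:Z - (s == j.+1 :> nat)%:Z, 0, 0))] => x.
rewrite big_seq1 mul1r /phase /= !mul0r addr0 mul0r addr0 vecE; congr e2pi.
by apply: eq_bigr => j _; rewrite mulrC intrD mulrNz.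
Qed.

Lemma Fourier_central (p q : int) : Fourier_polynomial (central p q : V -> C).
Proof.
exists [:: (1, (fun=> 0, p, q))] => x.
rewrite big_seq1 mul1r /phase /= big1 ?add0r // => j _.
by rewrite mul0r.
Qed.

Lemma Fourier_coef_prod (P : pred 'I_l.+1) j :
  Fourier_polynomial (fun x : V => (\prod_(s | P s) (1 + e2pi (vec x.1.1 0 s) *: 'X))`_j).
Proof.
suff H (r : seq 'I_l.+1) i : Fourier_polynomial (fun x : V =>
    (\prod_(s <- r | P s) (1 + e2pi (vec x.1.1 0 s) *: 'X))`_i) by exact: H.
elim: r i => [|s r IHr] i.
  suff -> : (fun x : V => (\prod_(s <- [::] | P s) (1 + e2pi (vec x.1.1 0 s) *: 'X))`_i)
    = (fun=> (i == 0%N)%:R) by exact: Fourier_const.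
  by apply/funext => x; rewrite big_nil coef1.
case Ps: (P s); last first.
  rewrite (_ : (fun _ => _) = (fun x : V =>
    (\prod_(s <- r | P s) (1 + e2pi (vec x.1.1 0 s) *: 'X))`_i)) //.
  by apply/funext => x; rewrite big_cons Ps.
have E : (fun x : V => (\prod_(s <- s :: r | P s) (1 + e2pi (vec x.1.1 0 s) *: 'X))`_i)
  = (fun x => (\prod_(s <- r | P s) (1 + e2pi (vec x.1.1 0 s) *: 'X))`_i +
      e2pi (vec x.1.1 0 s) * (if i is i'.+1 then
      (\prod_(s <- r | P s) (1 + e2pi (vec x.1.1 0 s) *: 'X))`_i' else 0)).
  apply/funext => x; rewrite big_cons Ps mulrDl mul1r coefD -scalerAl coefZ coefXM.
  by case: i {IHr}.
rewrite E; apply: FourierD => //; apply: FourierM; first exact: Fourier_vec.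
by case: i {E} => [|i]; [exact: Fourier_const | exact: IHr].
Qed.

End FourierExamples.

(** * Membership and invariance of the generators *)

Section Generators.
Variables (R : realType) (l k : nat).
Hypothesis hkl : (k < l)%N.
Local Notation C := R[i].
Local Notation V := (Vtilde C l).

(** The integrality that makes the generators Fourier polynomials in
    x_(l+1) / (l+1) and x_(l+2) / (l+1). *)
Lemma prefactorE j : (j <= l)%N -> prefactor k j =
  central ((minn j k * l.+1)%:Z - (j * k)%:Z)
          ((minn j k.+1 * l.+1)%:Z - (j * k.+1)%:Z) :> (V -> C).
Proof.
move=> jl; have kl : (k <= l)%N by apply: ltnW.
apply/funext => x; rewrite /prefactor /central !d_min ?leqW //; congr e2pi.
have l0 : l.+1%:R != 0 :> C by rewrite pnatr_eq0.
have rdiv (m n : nat) : (m%:R - n%:R / l.+1%:R : R)%:C =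
    ((m * l.+1)%:Z - n%:Z)%:~R / l.+1%:R.
  rewrite rmorphB fmorph_div !rmorph_nat intrB -!pmulrn natrM mulrBl mulfK //.
by rewrite !rdiv [RHS]mulrDl mulrAC [X in _ + X]mulrAC.
Qed.

Lemma Fourier_prefactor j : (j <= l)%N -> Fourier_polynomial (prefactor k j : V -> C).
Proof. by move=> jl; rewrite prefactorE //; apply: Fourier_central. Qed.

Lemma Fourier_ytilde j : Fourier_polynomial (ytilde k j : V -> C).
Proof.
rewrite /ytilde; case: leqP => [jl|_].
  apply: FourierM; first exact: Fourier_prefactor.
  rewrite (_ : (fun x : V => y_ j x.1.1) = fun x =>
    (\prod_(s < l.+1) (1 + e2pi (vec x.1.1 0 s) *: 'X))`_j); last first.
    by apply/funext => x; rewrite y_coef.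
  exact: Fourier_coef_prod.
have l0 : l.+1%:R != 0 :> C by rewrite pnatr_eq0.
case: eqP => _.
  rewrite (_ : (fun x : V => e2pi x.1.2) = central l.+1%:Z 0).
    exact: Fourier_central.
  by apply/funext => x; rewrite /central mul0r addr0 mulrAC divff ?mul1r.
rewrite (_ : (fun x : V => e2pi x.2) = central 0 l.+1%:Z).
  exact: Fourier_central.
by apply/funext => x; rewrite /central mul0r add0r mulrAC divff ?mul1r.
Qed.

Lemma Fourier_raypoly0 a j : Fourier_polynomial (fun x : V => (raypoly k a j x).[0]).
Proof.
rewrite /raypoly; case: leqP => [jl|lj].
  rewrite (_ : (fun x => _) = fun x : V => prefactor k j x * \sum_(i < j.+1)
     ((low (ray_weight k a) x.1.1)`_i * (high (ray_weight k a) x.1.1)`_(j - i)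
       * 0 ^+ (minn j (ray_weight k a) - i))).
    apply: FourierM; first exact: Fourier_prefactor.
    apply: Fourier_sum => i; apply: FourierM; last exact: Fourier_const.
    by apply: FourierM; apply: Fourier_coef_prod.
  apply/funext => x; rewrite hornerZ horner_sum; congr (_ * _).
  by apply: eq_bigr => i _; rewrite hornerZ hornerXn.
have := Fourier_ytilde j; rewrite /ytilde leqNgt lj /= => Fy.
case: eqP Fy => _ Fy.
  rewrite (_ : (fun x => _) = fun x : V => e2pi x.1.2 * 0 ^+ a).
    by apply: FourierM => //; exact: Fourier_const.
  by apply/funext => x; rewrite hornerZ hornerXn.
rewrite (_ : (fun x => _) = fun x : V => e2pi x.2 * 0 ^+ (~~ a)).
  by apply: FourierM => //; exact: Fourier_const.
by apply/funext => x; rewrite hornerZ hornerXn.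
Qed.

Lemma bounded_ytilde a j :
  bounded_along (ray_weight k a) a%:R (~~ a)%:R (ytilde k j : V -> C).
Proof.
move=> x0; have [M HM] := ray_poly_bounded (raypoly k a j (complexify x0)).
by exists M; near=> tau; rewrite ytilde_ray //; near: tau.
Unshelve. all: by end_near. Qed.

Definition permute (w : 'S_l.+1) (m : 'I_l -> int) (x : Vtilde R l) : Vtilde R l :=
  (coords (col_perm w (vec x.1.1) + \sum_j (m j)%:~R *: alpha R l j.+1), x.1.2, x.2).

Definition translate (a : bool) (x : Vtilde R l) : Vtilde R l :=
  (coords (vec x.1.1 + omega R l (ray_weight k a)), x.1.2 - a%:R, x.2 - (~~ a)%:R).

Lemma translate_true : translate true =
  (fun x => (coords (vec x.1.1 + omega R l k), x.1.2 - 1, x.2)).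
Proof. by apply/funext => x; rewrite /translate /= subr0. Qed.

Lemma translate_false : translate false =
  (fun x => (coords (vec x.1.1 + omega R l k.+1), x.1.2, x.2 - 1)).
Proof. by apply/funext => x; rewrite /translate /= subr0. Qed.

Lemma Wtilde_translate a : Wtilde k (translate a).
Proof.
case: a; first by rewrite translate_true; exact: Wtilde_omega1.
by rewrite translate_false; exact: Wtilde_omega2.
Qed.

Lemma Wtilde_invariant_generators (f : V -> C) :
  (forall w m x, f (complexify (permute w m x)) = f (complexify x)) ->
  (forall a x, f (complexify (translate a x)) = f (complexify x)) ->
  Wtilde_invariant k f.
Proof.
move=> fP fT g; elim=> [w m|||//|{}g h _ IHg _ IHh|{}g h _ IHg gK hK] x.
- exact: fP.
- by have := fT true x; rewrite translate_true.
- by have := fT false x; rewrite translate_false.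
- by rewrite -[LHS]/(f (complexify (g (h x)))) IHg IHh.
- by rewrite -[in RHS](hK x) IHg.
Qed.

Lemma e2pi_vec_permute w m x s :
  e2pi (vec (complexify (permute w m x)).1.1 0 s) =
  e2pi (vec (complexify x).1.1 0 (w s)).
Proof.
rewrite /permute; have -> : \sum_j (m j)%:~R *: alpha R l j.+1 = vec (\row_j (m j)%:~R).
  by apply: eq_bigr => j _; rewrite mxE.
rewrite /= !vec_map coordsK; last first.
  apply: inV_add (vec_inV _); rewrite /inV -[RHS](vec_inV x.1.1).
  rewrite [RHS](reindex_inj (@perm_inj _ w)).
  by apply: eq_bigr => t _; rewrite mxE.
have mE : vec (\row_j (m j)%:~R : 'rV[R]_l) 0 s =
    (\sum_(j < l) m j * ((s == j :> nat)%:Z - (s == j.+1 :> nat)%:Z))%:~R.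
  rewrite vecE rmorph_sum; apply: eq_bigr => j _.
  by rewrite mxE rmorphM rmorphB.
by rewrite !mxE mE rmorphD e2piD rmorph_int e2pi_int mulr1.
Qed.

Lemma e2pi_vec_translate a x s :
  e2pi (vec (complexify (translate a x)).1.1 0 s) =
  e2pi (vec (complexify x).1.1 0 s) *
  e2pi (- ((ray_weight k a)%:R / l.+1%:R : R)%:C).
Proof.
have rl := ray_weight_le hkl a.
rewrite /translate /= !vec_map coordsK; last first.
  by apply: inV_add; [exact: vec_inV | apply: omega_inV; exact: leqW].
by rewrite !mxE !rmorphD !rmorphN !e2piD rmorph_nat e2pi_nat mul1r.
Qed.

Lemma ytilde_permute w m j x :
  ytilde k j (complexify (permute w m x)) = ytilde k j (complexify x).
Proof.
have yE : y_ j (complexify (permute w m x)).1.1 = y_ j (complexify x).1.1.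
  rewrite [LHS]y_coef [RHS]y_coef [in RHS](reindex_inj (@perm_inj _ w)).
  congr (nth 0 (polyseq _) _); apply: eq_bigr => s _.
  by rewrite e2pi_vec_permute.
by rewrite /ytilde yE.
Qed.

(** Translation by omega_r multiplies y_j by exp (2 pi i (omega_j, omega_r)),
    because the entries of omega_r are congruent to - r / (l+1) modulo 1, and
    shifting the central variable by -1 multiplies the prefactor by the
    inverse. *)
Lemma ytilde_translate a j x :
  ytilde k j (complexify (translate a x)) = ytilde k j (complexify x).
Proof.
have e2piB1 (t : R) (b : bool) : e2pi (t - b%:R)%:C = e2pi t%:C.
  by rewrite rmorphB e2piD e2piN rmorph_nat e2pi_nat invr1 mulr1.
have x1E : e2pi (complexify (translate a x)).1.2 = e2pi (complexify x).1.2.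
  exact: e2piB1.
have x2E : e2pi (complexify (translate a x)).2 = e2pi (complexify x).2.
  exact: e2piB1.
rewrite /ytilde.
case: leqP => [jl|_]; last first.
  by case: eqP => _.
set r := ray_weight k a; have rl : (r <= l)%N := ray_weight_le hkl a.
have yE : y_ j (complexify (translate a x)).1.1 =
    y_ j (complexify x).1.1 * e2pi (d_ R l j r)%:C.
  rewrite [y_ _ _ in LHS]y_coef [y_ _ _ in RHS]y_coef.
  rewrite (eq_bigr _ (fun s _ => congr1 (fun z => 1 + z *: 'X)
    (e2pi_vec_translate a x s))).
  rewrite coef_prod_1DX_scale mulrC; congr (_ * _).
  rewrite -e2piMn d_min ?leqW // rmorphB e2piD rmorph_nat e2pi_nat mul1r.
  by rewrite natrM -mulrA (rmorphM _ j%:R) rmorph_nat mulrN.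
have prefE : prefactor k j (complexify (translate a x)) =
    prefactor k j (complexify x) * e2pi (- (d_ R l j r)%:C).
  rewrite /prefactor -e2piD; congr e2pi; rewrite /r.
  by case: (a); rewrite /= ?subr0 rmorphB; ring.
rewrite -[LHS]/(prefactor k j (complexify (translate a x)) * _) prefE yE.
by rewrite mulrACA e2piN mulVf ?e2pi_neq0 ?mulr1.
Qed.

Lemma inA_ytilde j : inA k (ytilde k j : V -> C).
Proof.
split; first exact: Fourier_ytilde.
- apply: Wtilde_invariant_generators => [w m|a] x.
    exact: ytilde_permute.
  exact: ytilde_translate.
- exact: (bounded_ytilde true).
- exact: (bounded_ytilde false).
Qed.

Lemma inA_meval_ytilde (p : mpoly l.+2 C) :
  inA k (fun x : V => meval (fun j : 'I_l.+2 => ytilde k j.+1 x) p).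
Proof.
apply: meval_closure => [c|f g Af Ag|f g Af Ag|j].
- split => //; first exact: Fourier_const.
  + by move=> x0; exists (complex.Re `|c|); near=> tau; rewrite RRe_real ?normr_real.
  + by move=> x0; exists (complex.Re `|c|); near=> tau; rewrite RRe_real ?normr_real.
- by apply/asboolP; apply: (rpredD (S := A_pred k)); apply/asboolP.
- by apply/asboolP; apply: (rpredM (s := A_pred k)); apply/asboolP.
exact: inA_ytilde.
Unshelve. all: by end_near. Qed.

End Generators.

(** * Surjectivity of the limit map *)

Section LimitMap.
Variables (R : realType) (l k : nat).
Hypotheses (hk : (1 <= k)%N) (hkl : (k < l)%N).
Local Notation C := R[i].
Local Notation V := (Vtilde C l).

(** Only the term with the maximal number min j r of entries s < r survives in
    the limit. *)
Lemma raypoly0 a j (x : V) : (j <= l)%N ->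
  let m := minn j (ray_weight k a) in
  (raypoly k a j x).[0] = prefactor k j x *
    ((low (ray_weight k a) x.1.1)`_m * (high (ray_weight k a) x.1.1)`_(j - m)).
Proof.
move=> jl /=; set r := ray_weight k a; have rl : (r <= l)%N := ray_weight_le hkl a.
rewrite /raypoly jl -/r hornerZ horner_sum; congr (_ * _).
have mj : (minn j r < j.+1)%N by rewrite ltnS geq_minl.
rewrite (bigD1 (Ordinal mj)) //= hornerZ hornerXn subnn mulr1 big1 ?addr0 // => i.
rewrite -val_eqE /= neq_ltn hornerZ hornerXn => /orP[im|mi].
  by rewrite expr0n subn_eq0 leqNgt im mulr0.
have ri : (r < i)%N by move: mi; rewrite gtn_min ltnNge -ltnS ltn_ord.
rewrite [(low r x.1.1)`_i]nth_default ?mul0r // (leq_trans (size_prod_1DX _ _)) //.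
by rewrite card_ord_lt ?leqW.
Qed.

(** Logarithms are chosen freely for all entries but the last, which is then
    forced by the condition of being in V and has the right exponential
    because the product of the z_s is 1. *)
Lemma exists_torus_point (z : 'I_l.+1 -> C) :
  (forall s, z s != 0) -> \prod_s z s = 1 ->
  exists x : 'rV[C]_l, forall s, e2pi (vec x 0 s) = z s.
Proof.
move=> z0 z1.
have [v vE] := boolp.choice (fun s => e2pi_surj (z0 s)).
pose w : 'rV[C]_l.+1 :=
  \row_s (if s == ord_max then - \sum_(t | t != ord_max) v t else v s).
have wV : inV w.
  rewrite /inV (bigD1 ord_max) //= mxE eqxx (eq_bigr v) ?addNr // => s /negPf sm.
  by rewrite mxE sm.
exists (coords w) => s; rewrite coordsK // mxE; case: eqP => [->|_] //.
rewrite e2piN e2pi_sum (eq_bigr z) => [|t _ //]; apply/esym/eqP.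
move: z1; rewrite (bigD1 ord_max) //= => z1.
have P0 : \prod_(t | t != ord_max) z t != 0 by apply/prodf_neq0 => t _.
by apply/eqP/(mulIf P0); rewrite z1 mulVf.
Qed.

Lemma exists_low_high r (p q : {poly C}) : (r <= l.+1)%N ->
  p`_0 = 1 -> size p = r.+1 -> q`_0 = 1 -> size q = (l.+1 - r).+1 ->
  p`_r * q`_(l.+1 - r) = 1 ->
  exists x : 'rV[C]_l, low r x = p /\ high r x = q.
Proof.
move=> rl p0 sp q0 sq pq.
have [z1 [z1n pE pz]] := split_1DX p0 sp.
have [z2 [z2n qE qz]] := split_1DX q0 sq.
pose z s := if (s < r)%N then z1 s else z2 (s - r)%N.
have lowE (T : comNzRingType) (F : C -> T) :
    \prod_(s < l.+1 | (s < r)%N) F (z s) = \prod_(i < r) F (z1 i).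
  rewrite (big_ord_widen l.+1 (fun i => F (z1 i))) //.
  by apply: eq_bigr => s sr; rewrite /z sr.
have highE (T : comNzRingType) (F : C -> T) :
    \prod_(s < l.+1 | ~~ (s < r)%N) F (z s) = \prod_(i < l.+1 - r) F (z2 i).
  rewrite (eq_bigl (fun s : 'I_l.+1 => xpredT (val s) && (r <= s)%N)); last first.
    by move=> s; rewrite -leqNgt.
  rewrite -(big_geq_mkord r l.+1 xpredT (fun s => F (z s))).
  rewrite -{1}[r]add0n big_addn big_mkord; apply: eq_bigr => i _.
  by rewrite /z ltnNge leq_addl addnK.
have [s||x xE] := @exists_torus_point (fun s => z s).
- by rewrite /z; case: ifP.
- rewrite (bigID (fun s : 'I_l.+1 => (s < r)%N)) /=.
  by rewrite (lowE _ id) (highE _ id) pz qz.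
exists x; split.
  rewrite pE -(lowE _ (fun c => 1 + c *: 'X)).
  by apply: eq_bigr => s _; rewrite xE.
rewrite qE -(highE _ (fun c => 1 + c *: 'X)).
by apply: eq_bigr => s _; rewrite xE.
Qed.

(** The limits of the first l generators are, up to a nonzero prefactor, the
    coefficients of low r and, times the leading coefficient of low r, those
    of high r.  Hence prescribing nonzero limits amounts to prescribing two
    polynomials with constant coefficient 1 and inverse leading coefficients,
    which determine the point by factorization into linear factors. *)
Lemma raypoly0_surj a (c : nat -> C) :
  (forall j, (1 <= j <= l)%N -> c j != 0) ->
  (if a then c l.+1 = 0 /\ c l.+2 != 0 else c l.+1 != 0 /\ c l.+2 = 0) ->
  exists x : V, forall j, (1 <= j <= l.+2)%N -> (raypoly k a j x).[0] = c j.
Proof.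
move=> c0 ca.
have [u1 [u2 uE]] : exists u1 u2 : C,
    if a then e2pi u2 = c l.+2 else e2pi u1 = c l.+1.
  case: a ca => [[_ /e2pi_surj[u uE]]|[/e2pi_surj[u uE] _]].
    by exists 0, u.
  by exists u, 0.
pose pre j : C := prefactor k j ((0, u1, u2) : V).
have pre0 j : pre j != 0 by exact: e2pi_neq0.
pose d j := c j / pre j.
have d0 j : (1 <= j <= l)%N -> d j != 0.
  by move=> jl; rewrite mulf_neq0 ?invr_eq0 ?c0.
set r := ray_weight k a; have rl : (r <= l)%N := ray_weight_le hkl a.
have r1 : (1 <= r)%N by rewrite /r; case: (a).
have dr : d r != 0 by rewrite d0 ?r1.
(* The targets for low r and high r. *)
pose p : {poly C} := \poly_(i < r.+1) (if i == 0%N then 1 else d i).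
pose q : {poly C} := \poly_(i < (l.+1 - r).+1)
  (if i == 0%N then 1 else if i == (l.+1 - r)%N then (d r)^-1 else d (r + i)%N / d r).
have lr : (l.+1 - r)%N != 0%N by rewrite subn_eq0 -ltnNge ltnS.
have [|||||x [xp xq]] := @exists_low_high r p q (leqW rl).
- by rewrite coef_poly.
- by rewrite size_poly_eq // gtn_eqF.
- by rewrite coef_poly.
- by rewrite size_poly_eq // (negPf lr) eqxx invr_eq0.
- by rewrite !coef_poly !ltnS !leqnn (negPf lr) eqxx gtn_eqF // divff.
exists (x, u1, u2) => j /andP[j1 jl2].
have [jl|lj] := leqP j l; last first.
  rewrite /raypoly leqNgt lj /=.
  case: eqP jl2 => [->|/eqP jN] jl2; rewrite hornerZ hornerXn /=.
    by move: ca uE; case: (a) => [[-> _] _|_ ->]; rewrite ?mulr0 // mulr1.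
  have -> : j = l.+2 by apply/eqP; rewrite eqn_leq jl2 ltn_neqAle eq_sym jN.
  by move: ca uE; case: (a) => [_ ->|[_ ->] _]; rewrite ?mulr0 // mulr1.
rewrite raypoly0 // -/r /= xp xq -[prefactor _ _ _]/(pre j).
have dE : pre j * d j = c j by rewrite mulrC divfK.
rewrite -[RHS]dE; congr (_ * _); rewrite !coef_poly.
have [jr|rj] := leqP j r.
  rewrite subnn ltnS jr /= mulr1.
  by rewrite gtn_eqF.
rewrite leqnn gtn_eqF // ltnS leq_sub2r ?(leqW jl) // subn_eq0 leqNgt rj /=.
rewrite subnKC ?(ltnW rj) // ifN; first by rewrite mulrC divfK.
by rewrite ltn_eqF // ltn_sub2r // (leq_trans rj).
Qed.

End LimitMap.

(** * Divisibility by the central generators *)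

Section Descent.
Variables (R : realType) (l k : nat).
Hypotheses (hk : (1 <= k)%N) (hkl : (k < l)%N).
Local Notation C := R[i].
Local Notation V := (Vtilde C l).
Local Notation evaly p x := (meval (fun j : 'I_l.+2 => ytilde k j.+1 x) p).

(** The 0-based index of the generator exp (2 pi i x_(l+1)) or
    exp (2 pi i x_(l+2)) that tends to 0 along the ray selected by a. *)
Definition central_var (a : bool) : 'I_l.+2 := inord (if a then l else l.+1).

Lemma central_varE a : central_var a = (if a then l else l.+1) :> nat.
Proof. by rewrite inordK //; case: a. Qed.

Lemma ytilde_central_var a (x : V) :
  ytilde k (central_var a).+1 x = e2pi (if a then x.1.2 else x.2).
Proof.
rewrite central_varE /ytilde; case: a; rewrite ?ltnn ?eqxx //.
by rewrite ltnNge leqnSn /= gtn_eqF.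
Qed.

(** Along the ray the left-hand side is O(decay), as f is bounded and the
    central generator is proportional to the decay, and the right-hand side
    is a polynomial in the decay, whose constant coefficient is the claimed
    value. *)
Lemma limit_vanish a (f : V -> C) M (H : mpoly l.+2 C) (x0 : Vtilde R l) :
  bounded_along (ray_weight k a) a%:R (~~ a)%:R f ->
  (forall x, f x * ytilde k (central_var a).+1 x ^+ M.+1 = evaly H x) ->
  meval (fun j : 'I_l.+2 => (raypoly k a j.+1 (complexify x0)).[0]) H = 0.
Proof.
move=> fb fH.
have [h hE] := horner_meval (fun j : 'I_l.+2 => raypoly k a j.+1 (complexify x0)) H.
have [B HB] := fb x0.
pose u := e2pi (if a then x0.1.2 else x0.2)%:C.
have uE : (complex.Re (`|u| ^+ M.+1))%:C = `|u| ^+ M.+1.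
  by apply: RRe_real; apply: ger0_real; rewrite exprn_ge0.
rewrite -hE; apply: (@ray_poly_vanish _ _ (B * complex.Re (`|u| ^+ M.+1))).
near=> tau.
have -> : h.[(decay tau)%:C] = evaly H (ray (ray_weight k a) a%:R (~~ a)%:R x0 tau).
  by rewrite hE; apply: meval_eq => j; rewrite ytilde_ray.
have d0 : 0 <= decay tau by apply: expR_ge0.
have d1 : decay tau <= 1 by rewrite ltW //; near: tau; exact: decay_small.
have -> : (B * complex.Re (`|u| ^+ M.+1) * decay tau)%:C =
    B%:C * (`|u| ^+ M.+1 * (decay tau)%:C).
  by rewrite mulrA -uE -!rmorphM.
rewrite -fH normrM ytilde_ray //.
have -> : (raypoly k a (central_var a).+1 (complexify x0)).[(decay tau)%:C] =
    u * (decay tau)%:C.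
  rewrite central_varE /raypoly /u; case: (a).
    by rewrite ltnn eqxx hornerZ hornerXn.
  by rewrite ltnNge leqnSn /= gtn_eqF // hornerZ hornerXn.
rewrite normrX normrM exprMn [`|_%:C|]ger0_norm ?ler0c //.
have B0 : 0 <= `|f (ray (ray_weight k a) a%:R (~~ a)%:R x0 tau)| by [].
have fB : `|f (ray (ray_weight k a) a%:R (~~ a)%:R x0 tau)| <= B%:C.
  by near: tau.
have dC : 0 <= (decay tau)%:C by rewrite ler0c.
apply: ler_pM => //; first by rewrite mulr_ge0 ?exprn_ge0.
apply: ler_wpM2l; first by rewrite exprn_ge0.
by rewrite -rmorphXn lecR exprS ler_piMr ?exprn_ile1.
Unshelve. all: by end_near. Qed.

(** The limits of the generators are Fourier polynomials in the base point, so
    that H vanishes at the limits from all complex base points; these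
    limits fill a dense part of the hyperplane where the central variable is
    0. *)
Lemma descent a (f : V -> C) M (H : mpoly l.+2 C) :
  inA k f ->
  (forall x, f x * ytilde k (central_var a).+1 x ^+ M.+1 = evaly H x) ->
  exists H', H = mpolyX C (mnm1 (central_var a)) * H' /\
    (forall x, f x * ytilde k (central_var a).+1 x ^+ M = evaly H' x).
Proof.
move=> [_ _ fk fk1] fH.
have fb : bounded_along (ray_weight k a) a%:R (~~ a)%:R f by case: (a).
have lim0 (x : V) : meval (fun j : 'I_l.+2 => (raypoly k a j.+1 x).[0]) H = 0.
  move: x; apply: Fourier_eq0 => [|x0]; last exact: limit_vanish fb fH.
  apply: (meval_closure (g := fun (j : 'I_l.+2) (x : V) => (raypoly k a j.+1 x).[0])).
  - exact: Fourier_const.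
  - exact: FourierD.
  - exact: FourierM.
  - by move=> i; apply: Fourier_raypoly0.
have [H' HE] : exists H', H = mpolyX C (mnm1 (central_var a)) * H'.
  apply: mpoly_factor_var => c ca c0.
  pose c' j := c (inord j.-1).
  have cE (j : 'I_l.+2) : c' j.+1 = c j by rewrite /c' inord_val.
  have c'0 j : (j <= l.+1)%N -> j <> central_var a -> c' j.+1 != 0.
    move=> jl jN; apply: c0; apply/eqP => E; apply: jN; rewrite -E /=.
    by rewrite inordK.
  have c'a : c' (central_var a).+1 = 0 by rewrite cE.
  have [[|j] // /andP[_ jl]||x xE] := @raypoly0_surj R l k hk hkl a c'.
  - by apply: c'0; rewrite ?central_varE; case: (a); lia.
  - move: c'a c'0; rewrite central_varE; case: (a) => c'a c'0.
      by split=> //; apply: c'0 => //; lia.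
    by split=> //; apply: c'0; lia.
  rewrite -(lim0 x); apply: meval_eq => j.
  by rewrite xE ?cE // ltn_ord.
exists H'; split=> // x.
have y0 : ytilde k (central_var a).+1 x != 0 by rewrite ytilde_central_var e2pi_neq0.
by apply: (mulIf y0); rewrite -mulrA -exprSr fH HE mevalM mevalXU mulrC.
Qed.

End Descent.

(** * Averaging over the group *)

Section Laurent.
Variables (R : realType) (l k : nat).
Hypothesis hkl : (k < l)%N.
Local Notation C := R[i].
Local Notation V := (Vtilde C l).
Local Notation evaly p x := (meval (fun j : 'I_l.+2 => ytilde k j.+1 x) p).

Definition laurent_sum (s : seq (mpoly l.+2 C * int * int)) (x : V) : C :=
  \sum_(t <- s) evaly t.1.1 x * central t.1.2 t.2 x.

(** Polynomials in the generators with the central exponentials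
    exp (2 pi i x_(l+1) / (l+1)) and exp (2 pi i x_(l+2) / (l+1)) and their
    inverses adjoined, as functions on the real space. *)
Definition laurent (f : Vtilde R l -> C) : Prop :=
  exists s, forall x, f x = laurent_sum s (complexify x).

Lemma laurent_term (p : mpoly l.+2 C) m n :
  laurent (fun x => evaly p (complexify x) * central m n (complexify x)).
Proof. by exists [:: (p, m, n)] => x; rewrite /laurent_sum big_seq1. Qed.

Lemma laurent_central m n : laurent (fun x => central m n (complexify x)).
Proof.
by exists [:: (1, m, n)] => x; rewrite /laurent_sum big_seq1 /= meval1 mul1r.
Qed.

Lemma laurent_const c : laurent (fun=> c).
Proof.
exists [:: (mpolyC l.+2 c, 0, 0)] => x.
by rewrite /laurent_sum big_seq1 /= mevalC central0 mulr1.
Qed.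

Lemma laurentD f g : laurent f -> laurent g -> laurent (fun x => f x + g x).
Proof.
move=> [s fE] [t gE]; exists (s ++ t) => x.
by rewrite /laurent_sum big_cat fE gE.
Qed.

Lemma laurentM f g : laurent f -> laurent g -> laurent (fun x => f x * g x).
Proof.
move=> [s fE] [t gE].
exists [seq (u.1.1 * v.1.1, u.1.2 + v.1.2, u.2 + v.2) | u <- s, v <- t] => x.
rewrite /laurent_sum fE gE big_allpairs_dep mulr_suml.
apply: eq_bigr => u _; rewrite mulr_sumr; apply: eq_bigr => v _.
by rewrite /= mevalM centralD mulrACA.
Qed.

Lemma laurent_sumr (I : Type) (r : seq I) (F : I -> Vtilde R l -> C) :
  (forall i, laurent (F i)) -> laurent (fun x => \sum_(i <- r) F i x).
Proof.
move=> LF; elim: r => [|i r IHr].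
  suff -> : (fun x => \sum_(i <- [::]) F i x) = (fun=> 0) by exact: laurent_const.
  by apply/funext => x; rewrite big_nil.
suff -> : (fun x => \sum_(j <- i :: r) F j x) =
    (fun x => F i x + \sum_(j <- r) F j x) by exact: laurentD.
by apply/funext => x; rewrite big_cons.
Qed.

(** The case i = l is y_(l+1) = 1, the product of all exp (2 pi i v_s). *)
Lemma laurent_y (i : 'I_l.+1) : laurent (fun x => y_ i.+1 (complexify x).1.1).
Proof.
have [il|li] := ltnP i l; last first.
  suff -> : (fun x : Vtilde R l => y_ i.+1 (complexify x).1.1) = (fun=> 1 : C).
    exact: laurent_const.
  apply/funext => x; rewrite /y_ (_ : i.+1 = l.+1); last first.
    by apply/eqP; rewrite eqSS eqn_leq li -ltnS ltn_ord.
  rewrite mesymnnE rmorph_prod /= -[RHS](prod_e2pi_vec (complexify x).1.1).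
  by apply: eq_bigr => s _; rewrite mevalXU.
pose p : int := (i.+1 * k)%:Z - (minn i.+1 k * l.+1)%:Z.
pose q : int := (i.+1 * k.+1)%:Z - (minn i.+1 k.+1 * l.+1)%:Z.
suff -> : (fun x : Vtilde R l => y_ i.+1 (complexify x).1.1) =
    (fun x => evaly (mpolyX C (mnm1 (inord i))) (complexify x) *
       central p q (complexify x)) by exact: laurent_term.
apply/funext => x; rewrite mevalXU /ytilde inordK; last exact: leqW.
rewrite il.
rewrite -[e2pi (_ * _ + _)]/(prefactor k i.+1 (complexify x)).
rewrite prefactorE // mulrAC -centralD.
by rewrite /p /q !subrKA !subrr central0 mul1r.
Qed.

Lemma laurent_orbit_sum (m : ('I_l -> int) * int * int) :
  laurent (fun x : Vtilde R l =>
    \sum_(w : 'S_l.+1) e2pi (phase m (complexify (permute w (fun=> 0) x)))).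
Proof.
have [a aE] := char_monomial R m.
have [q qE] := sym_orbit_sum (mpolyX C a).
suff -> : (fun x : Vtilde R l =>
    \sum_(w : 'S_l.+1) e2pi (phase m (complexify (permute w (fun=> 0) x)))) =
    (fun x => meval (fun i : 'I_l.+1 => y_ i.+1 (complexify x).1.1) q *
      central m.1.2 m.2 (complexify x)).
  apply: laurentM; last exact: laurent_central.
  apply: (meval_closure (g := fun i : 'I_l.+1 => fun x : Vtilde R l =>
      y_ i.+1 (complexify x).1.1)).
  - exact: laurent_const.
  - exact: laurentD.
  - exact: laurentM.
  - exact: laurent_y.
apply/funext => x.
rewrite -[meval _ q](qE (fun s => e2pi (vec (complexify x).1.1 0 s))) mulr_suml.
apply: eq_bigr => w _; rewrite aE; congr (_ * _).
by apply: meval_eq => s; rewrite e2pi_vec_permute.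
Qed.

(** An invariant function is the average of its permuted copies, and averaging
    replaces each character by a symmetric polynomial. *)
Lemma invariant_laurent (f : V -> C) :
  Fourier_polynomial f -> Wtilde_invariant k f ->
  laurent (fun x => f (complexify x)).
Proof.
move=> [s fE] fW.
have n0 : (#|'S_l.+1|)%:R != 0 :> C.
  by rewrite pnatr_eq0 -lt0n; apply/card_gt0P; exists 1%g.
suff -> : (fun x => f (complexify x)) = (fun x : Vtilde R l =>
    (#|'S_l.+1|)%:R^-1 * \sum_(t <- s) t.1 *
    \sum_(w : 'S_l.+1) e2pi (phase t.2 (complexify (permute w (fun=> 0) x)))).
  apply: laurentM; first exact: laurent_const.
  apply: laurent_sumr => t; apply: laurentM; first exact: laurent_const.
  exact: laurent_orbit_sum.
apply/funext => x; apply: (mulfI n0); rewrite mulVKf //.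
under [RHS]eq_bigr do rewrite mulr_sumr.
rewrite exchange_big /= mulr_natl -sumr_const; apply: eq_bigr => w _.
by rewrite -fE fW //; apply: Wtilde_affine.
Qed.

(** Average over the translates by 0, ..., l times the generator.  The
    polynomials in the generators are invariant, and the central exponential
    of exponent P is multiplied by zeta = exp (- 2 pi i P / (l+1)), whose
    powers sum to zero unless l+1 divides P. *)
Lemma laurent_sum_translate a s (f : Vtilde R l -> C) :
  (forall x, f x = laurent_sum s (complexify x)) ->
  (forall x, f (translate k a x) = f x) ->
  forall x, f x = laurent_sum
    [seq t <- s | (l.+1 %| (if a then t.1.2 else t.2))%Z] (complexify x).
Proof.
move=> fE fT x.
pose P (t : mpoly l.+2 C * int * int) := if a then t.1.2 else t.2.
pose zeta t := e2pi ((- (P t)%:~R / l.+1%:R : R)%:C).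
pose term (t : mpoly l.+2 C * int * int) (y : V) :=
  evaly t.1.1 y * central t.1.2 t.2 y.
have n0 : l.+1%:R != 0 :> C by rewrite pnatr_eq0.
have shiftE (b : bool) (p q : int) (u v : R) :
    (p%:~R * (u - b%:R)%:C + q%:~R * (v - (~~ b)%:R)%:C) / l.+1%:R =
    (p%:~R * u%:C + q%:~R * v%:C) / l.+1%:R +
    (- (if b then p else q)%:~R / l.+1%:R : R)%:C.
  rewrite rmorphM rmorphN fmorphV !rmorphB rmorph_int !rmorph_nat.
  by rewrite -mulrDl; congr (_ / _); case: b => /=; ring.
have termT t y : term t (complexify (translate k a y)) = term t (complexify y) * zeta t.
  rewrite /term -mulrA; congr (_ * _).
    by apply: meval_eq => j; rewrite ytilde_translate.
  by rewrite /central /zeta -e2piD -shiftE.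
(* Both sides are f at the i-th iterated translate of y. *)
have fX i y : \sum_(t <- s) term t (complexify y) * zeta t ^+ i = f y.
  elim: i y => [|i IHi] y.
    by rewrite fE; apply: eq_bigr => t _; rewrite mulr1.
  by rewrite -fT -IHi; apply: eq_bigr => t _; rewrite termT exprS mulrA.
have zetaP t : zeta t = 1 <-> (l.+1 %| P t)%Z.
  split=> [|/dvdzP[q Pq]].
    by rewrite /zeta -mulrNz => /e2pi_eq1 => /(_ isT); rewrite dvdzE abszN.
  rewrite /zeta Pq intrM -mulNr mulfK ?pnatr_eq0 //.
  by rewrite -mulrNz rmorph_int e2pi_int.
have zetaX t : zeta t ^+ l.+1 = 1.
  rewrite -e2piMn rmorphM fmorphV rmorph_nat mulrCA divff // mulr1.
  by rewrite -mulrNz rmorph_int e2pi_int.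
have zeta_sum t : \sum_(i < l.+1) zeta t ^+ i =
    if (l.+1 %| P t)%Z then l.+1%:R else 0.
  case: ifPn => [/zetaP->|nP].
    under eq_bigr do rewrite expr1n.
    by rewrite sumr_const card_ord.
  have z1 : zeta t - 1 != 0 by rewrite subr_eq0; apply: contraNneq nP => /zetaP.
  by apply: (mulfI z1); rewrite mulr0 -subrX1 zetaX subrr.
apply: (mulfI n0); rewrite mulr_natl -[X in _ *+ X](card_ord l.+1) -sumr_const.
under eq_bigr => i _ do rewrite -(fX i x).
rewrite exchange_big /laurent_sum big_filter [in RHS]big_mkcond mulr_sumr.
apply: eq_bigr => t _; rewrite -mulr_sumr zeta_sum /P mulrC.
by case: ifP; rewrite ?mul0r ?mulr0.
Qed.

End Laurent.

(** * The isomorphism *)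

Section Chevalley.
Variables (R : realType) (l k : nat).
Hypotheses (hk : (1 <= k)%N) (hkl : (k < l)%N).
Local Notation C := R[i].
Local Notation V := (Vtilde C l).
Local Notation evaly p x := (meval (fun j : 'I_l.+2 => ytilde k j.+1 x) p).

Lemma clear_denominator a (f : V -> C) M (H : mpoly l.+2 C) :
  inA k f ->
  (forall x, f x * ytilde k (central_var l a).+1 x ^+ M = evaly H x) ->
  exists H', forall x, f x = evaly H' x.
Proof.
move=> Af; elim: M H => [|M IHM] H fH; first by exists H => x; rewrite -fH mulr1.
by have [H' [_ /IHM]] := descent hk hkl Af fH.
Qed.

(** Infinite descent: applied to f = 0, the descent lemma divides a relation
    by a variable and yields another relation of smaller degree. *)
Lemma ytilde_alg_indep (p : mpoly l.+2 C) :
  (forall x : V, evaly p x = 0) -> p = 0.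
Proof.
have [n] := ubnP (msize p); elim: n p => // n IHn p pn p0.
have [->//|pN0] := eqVneq p 0.
(* The relation reads 0 * ytilde ^+ 1 = p (ytilde). *)
have A0 : inA k (fun _ : V => 0 : C).
  have := inA_meval_ytilde hkl (0 : mpoly l.+2 C).
  by rewrite (_ : (fun x => _) = fun=> 0) //; apply/funext => x; rewrite meval0.
have [|q [pE qE]] := @descent R l k hk hkl true _ 0 p A0.
  by move=> x; rewrite mul0r p0.
have q0 : q != 0 by apply: contraNneq pN0 => q0; rewrite pE q0 mulr0.
have X0 : mpolyX C (mnm1 (central_var l true)) != 0.
  by rewrite -msize_poly_eq0 msizeX.
suff qz : q = 0 by rewrite qz eqxx in q0.
apply: IHn => [|x]; last by rewrite -qE mul0r.
by move: pn; rewrite pE msizeM // msizeX mdeg1.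
Qed.

Lemma divisible_laurent_sum s :
  (forall t, t \in s -> (l.+1 %| t.1.2)%Z && (l.+1 %| t.2)%Z) ->
  exists N (H : mpoly l.+2 C), forall x : V,
    laurent_sum k s x * ytilde k (central_var l false).+1 x ^+ N
      * ytilde k (central_var l true).+1 x ^+ N = evaly H x.
Proof.
move=> sdiv.
pose e (p : int) := (p %/ l.+1)%Z.
pose N := (\sum_(t <- s) (absz (e t.1.2) + absz (e t.2)))%N.
exists N, (\sum_(t <- s) t.1.1 *
  (mpolyX C (mnm1 (central_var l true)) ^+ absz (e t.1.2 + N%:Z) *
   mpolyX C (mnm1 (central_var l false)) ^+ absz (e t.2 + N%:Z))) => x.
rewrite /laurent_sum raddf_sum !mulr_suml; apply: eq_big_seq => t ts /=.
have /andP[/divzK d1 /divzK d2] := sdiv t ts.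
have n0 : l.+1%:R != 0 :> C by rewrite pnatr_eq0.
have centralE : central t.1.2 t.2 x = e2pi ((e t.1.2)%:~R * x.1.2 + (e t.2)%:~R * x.2).
  rewrite /central -{1}d1 -{1}d2 -/(e t.1.2) -/(e t.2); congr e2pi.
  by rewrite !intrM mulrAC [X in _ + X]mulrAC -mulrDl mulfK.
have bnd : (absz (e t.1.2) + absz (e t.2) <= N)%N.
  by rewrite /N (big_rem t ts) leq_addr.
have yX a n : evaly (mpolyX C (mnm1 (central_var l a)) ^+ n) x =
    e2pi (if a then x.1.2 else x.2) ^+ n.
  rewrite rmorphXn -(ytilde_central_var k a); congr (_ ^+ n).
  exact: (mevalXU (fun j : 'I_l.+2 => ytilde k j.+1 x)).
rewrite !mevalM !yX !ytilde_central_var centralE -!mulrA; congr (_ * _).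
rewrite -!e2piMn -!e2piD; congr e2pi.
have absE (p : int) : (absz p <= N)%N -> (absz (p + N%:Z))%:R = p%:~R + N%:R :> C.
  move=> pN; have p0 : 0 <= p + N%:Z by lia.
  by rewrite -[LHS]/((absz (p + N%:Z))%:~R) gez0_abs // intrD.
rewrite !absE; [ring| |].
  by apply: leq_trans bnd; rewrite leq_addl.
by apply: leq_trans bnd; rewrite leq_addr.
Qed.

(** The averages over W and over both translations express f as a polynomial in
    the generators divided by powers of the two central ones; boundedness
    along each ray removes the corresponding denominator. *)
Lemma inA_polynomial (f : V -> C) : inA k f ->
  exists H : mpoly l.+2 C, forall x, f x = evaly H x.
Proof.
move=> Af; have [Ff fW _ _] := Af.
have fT a x : f (complexify (translate k a x)) = f (complexify x).
  by apply: fW; apply: Wtilde_translate.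
have [s fs] := invariant_laurent hkl Ff fW.
have fs1 := laurent_sum_translate hkl fs (fT true).
have fs2 := laurent_sum_translate hkl fs1 (fT false).
have [|N [H HE]] := @divisible_laurent_sum
  [seq t <- [seq t <- s | (l.+1 %| t.1.2)%Z] | (l.+1 %| t.2)%Z].
  by move=> t; rewrite !mem_filter => /and3P[-> ->].
have Fy j : Fourier_polynomial (fun x : V => ytilde k j x ^+ N).
  elim: (N) => [|n IHn]; first exact: Fourier_const.
  rewrite (_ : (fun x => _) = fun x : V => ytilde k j x * ytilde k j x ^+ n).
    by apply: FourierM => //; apply: Fourier_ytilde.
  by apply/funext => x; rewrite exprS.
pose f' (x : V) := f x * ytilde k (central_var l false).+1 x ^+ N.
have fH x : f' x * ytilde k (central_var l true).+1 x ^+ N = evaly H x.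
  move: x; apply: Fourier_eq.
  - by apply: FourierM => //; apply: FourierM.
  - by case: (inA_meval_ytilde hkl H).
  - by move=> x; rewrite /f' -HE -fs2.
have Af' : inA k f'.
  apply/asboolP; apply: (rpredM (s := A_pred k)); first exact/asboolP.
  apply/asboolP; have := inA_meval_ytilde hkl (mpolyX C (mnm1 (central_var l false)) ^+ N).
  rewrite (_ : (fun x => _) = fun x : V => ytilde k (central_var l false).+1 x ^+ N) //.
  by apply/funext => x; rewrite rmorphXn /= mevalXU.
have [H1 f'H1] := clear_denominator Af' fH.
exact: (clear_denominator Af f'H1).
Qed.

Definition ytilde_eval (p : mpoly l.+2 C) : ringA R l k :=
  RingA (introT (asboolP _) (inA_meval_ytilde hkl p)).

Lemma ytilde_eval_is_additive : GRing.zmod_morphism ytilde_eval.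
Proof.
by move=> p q; apply: val_inj; apply/funext => x; apply: mevalB.
Qed.

Lemma ytilde_eval_is_multiplicative : GRing.monoid_morphism ytilde_eval.
Proof.
split; first by apply: val_inj; apply/funext => x; apply: meval1.
by move=> p q; apply: val_inj; apply/funext => x; apply: mevalM.
Qed.

HB.instance Definition _ :=
  GRing.isZmodMorphism.Build _ _ ytilde_eval ytilde_eval_is_additive.
HB.instance Definition _ :=
  GRing.isMonoidMorphism.Build _ _ ytilde_eval ytilde_eval_is_multiplicative.

Lemma ytilde_eval_bij : bijective ytilde_eval.
Proof.
have inj : injective ytilde_eval.
  move=> p q pq; apply/eqP; rewrite -subr_eq0; apply/eqP/ytilde_alg_indep => x.
  rewrite mevalB; apply/eqP; rewrite subr_eq0; apply/eqP.
  exact: (congr1 (fun f : ringA R l k => f x) pq).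
have surj (f : ringA R l k) : exists p, ytilde_eval p = f.
  have [p pE] := inA_polynomial (elimT (asboolP _) (valP f)).
  by exists p; apply: val_inj; apply/funext => x; rewrite pE.
have [g gK] := boolp.choice surj.
by exists g => // p; apply: inj; rewrite gK.
Qed.

End Chevalley.

Theorem theorem2p4 (R : realType) (l k : nat) (hk : (1 <= k)%N)
    (hkl : (k < l)%N) :
  exists phi : {rmorphism mpoly l.+2 R[i] -> ringA R l k},
    (forall p x, phi p x = meval (fun j : 'I_l.+2 => ytilde k j.+1 x) p)
    /\ bijective phi.
Proof.
exists (ytilde_eval hkl); split=> [p x|]; first by [].
exact: ytilde_eval_bij.
Qed.
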